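(* Fix $1\le s<\infty$, $\alpha\ge 1$, and $1\le p,q,r\le\infty$. Then there exists a constant $C>0$ depending only on $p,q,r,s,\alpha$ such that $$N_\varphi^{\alpha}\,\|\varphi\|_{\dot W^{-1,s}(\mathbb T)}\;\ge\; C\,\frac{\|\varphi\|_{L^p(\mathbb T)}\,\|\varphi\|_{L^q(\mathbb T)}}{\|\varphi\|_{L^r(\mathbb T)}}$$ holds for all nonzero $\varphi\in C(\mathbb T,\mathbb R)$ with zero mean and $N_\varphi<\infty$ if and only if $$\alpha\ge 1\quad\text{and}\quad \frac1p+\frac1q-\frac1r\;\ge\;1+\frac1s .$$
   Context: $\mathbb T=\mathbb R/\mathbb Z$ is the one-dimensional torus with normalized Lebesgue measure (total mass $1$). $C(\mathbb T,\mathbb R)$ denotes the continuous real-valued functions on $\mathbb T$; zero mean means $\int_{\mathbb T}\varphi\,dx=0$. The convention $1/\infty=0$ is used. $N_\varphi$ denotes the number of times $\varphi$ changes sign on $\mathbb T$, i.e. the largest $m$ for which there are cyclically ordered distinct points $x_1,\dots,x_m\in\mathbb T$ with $\varphi(x_j)\varphi(x_{j+1})<0$ for $j=1,\dots,m$, where $x_{m+1}:=x_1$. For $1\le s<\infty$ with Hölder conjugate $s'\in(1,\infty]$, $$\|\varphi\|_{\dot W^{-1,s}(\mathbb T)}:=\sup\Big\{\Big|\int_{\mathbb T}\varphi u\,dx\Big| : u\in C^\infty(\mathbb T),\ \|u'\|_{L^{s'}(\mathbb T)}\le 1\Big\}.$$ *)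

(* Defs.v *)
From HB Require Import structures.
From mathcomp Require Import all_boot all_order all_algebra.
From mathcomp Require Import all_classical all_reals all_analysis.

Set Implicit Arguments.
Unset Strict Implicit.
Unset Printing Implicit Defensive.
Import Order.TTheory GRing.Theory Num.Theory.
Import numFieldNormedType.Exports.

Local Open Scope classical_set_scope.
Local Open Scope ring_scope.
Local Open Scope ereal_scope.

(* Functions on the torus R/Z are represented by 1-periodic functions on R;
   integrals and Lebesgue norms over the torus are taken over the fundamental
   domain [0, 1]. *)

Definition torus_measure (R : realType)
    : {measure set (measurableTypeR R) -> \bar R} :=
  mrestr (@lebesgue_measure R)
    (measurable_itv `[0%R, 1%R] : measurable (`[0%R, 1%R]%classic : set R)).

Definition torus_continuous (R : realType) (f : R -> R) : Prop :=
  periodic f 1%R /\ continuous f.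

Definition torus_smooth (R : realType) (f : R -> R) : Prop :=
  periodic f 1%R /\ forall (n : nat) (x : R), derivable (derive1n n f) x 1%R.

Definition zero_mean (R : realType) (f : R -> R) : Prop :=
  \int[torus_measure R]_x (f x)%:E = 0.

Definition torus_norm (R : realType) (p : \bar R) (f : R -> R) : \bar R :=
  'N[torus_measure R]_p[EFin \o f].

(* The points x_0, ..., x_(m-1) are distinct and cyclically ordered in R/Z iff
   they have lifts with x_0 < ... < x_(m-1) < x_0 + 1; ordS is the cyclic
   successor, so the last point is compared with the first one. *)
Definition has_sign_changes (R : realType) (f : R -> R) (m : nat) : Prop :=
  exists x : 'I_m -> R,
    [/\ forall i j : 'I_m, (i < j)%N -> (x i < x j)%R,
        forall i j : 'I_m, (x j < x i + 1)%R &
        forall i : 'I_m, (f (x i) * f (x (ordS i)) < 0)%R].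

(* +oo when there are arbitrarily many sign changes. *)
Definition sign_changes (R : realType) (f : R -> R) : \bar R :=
  ereal_sup [set m%:R%:E | m in [set m : nat | has_sign_changes f m]].

(* The dual norm of \dot W^{-1,s}. *)
Definition negative_sobolev_norm (R : realType) (s : R) (f : R -> R) : \bar R :=
  ereal_sup [set `| \int[torus_measure R]_x (f x * u x)%:E | |
    u in [set u : R -> R | torus_smooth u /\
            torus_norm (hoelder_conjugate s%:E) (derive1 u) <= 1]].

(* Main.v *)
Require Import Defs.
From HB Require Import structures.
From mathcomp Require Import all_boot all_order all_algebra.
From mathcomp Require Import all_classical all_reals all_analysis.
From mathcomp Require Import measurable_realfun ess_sup_inf.
From mathcomp Require Import ring lra zify.

(** Write N for the number of sign changes of phi, s' for the conjugate
exponent of s, and Phi for the primitive of phi of mean zero.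

Sufficiency rests on one endpoint inequality ([uncertainty_principle]):
N * |phi|_{-1,s} * |phi|_{s'} >= |phi|_1 ^ 2 / 48.  On an interval where phi
keeps its sign, Phi is monotone, so the integral of |Phi| |Phi'| over it is the
increment of Phi |Phi| / 2, which is at least a quarter of the squared
increment of Phi, that is, of the squared integral of |phi|
([signed_piece]).  The circle, cut open at 0, splits into at most 2 N such
intervals, and the Cauchy-Schwarz inequality yields
int |Phi| |phi| >= |phi|_1 ^ 2 / (8 N) ([few_alternations],
[alternation_bound]).  The left-hand side is seen by the negative norm: testing
phi against u amounts to integrating - Phi u', and the choice
u' = sign(Phi) |phi| - constant has L^{s'} norm controlled by that of phi.  This
u' is not smooth; a smooth one arbitrarily close to it exists because smooth
periodic functions are uniformly dense among the continuous periodic ones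
([elementary_dense], [smooth_test_function]).

The other exponents follow from the endpoint by convexity.  The function
x |-> log |phi|_{1/x} is convex and nonincreasing on [0, 1], and the hypothesis
on the exponents says 1/p + 1/q + 1/s' >= 1 + 1 + 1/r; hence
|phi|_p |phi|_q |phi|_{s'} <= |phi|_1 ^ 2 |phi|_r ([Lnorm_product_le]).  The
power alpha >= 1 only helps since N >= 1.

Necessity is a scaling argument.  The derivative of a bump of width w and height
w ^ 4 has size w ^ 3 on a set of measure comparable to w, so its L^p norm is
comparable to w ^ (3 + 1/p); it has a bounded number of sign changes, and by
duality its negative norm is at most the L^s norm of the bump, which is of order
w ^ (4 + 1/s).  Letting w tend to 0 in the inequality compares the exponents
([necessity], [exponent_comparison]). *)

Set Implicit Arguments.
Unset Strict Implicit.
Unset Printing Implicit Defensive.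
Import Order.TTheory GRing.Theory Num.Theory.
Import numFieldNormedType.Exports.

Local Open Scope classical_set_scope.
Local Open Scope ring_scope.

(** * Derivatives, primitives and integrals over the torus *)

Section calculus.
Context {R : realType}.
Implicit Types (f g F G : R -> R) (x a b k : R).

Lemma is_derive1D f g x a b : is_derive x (1 : R) f a -> is_derive x (1 : R) g b ->
  is_derive x (1 : R) (fun y => f y + g y) (a + b).
Proof. by move=> df dg; exact: (is_deriveD df dg). Qed.

Lemma is_derive1B f g x a b : is_derive x (1 : R) f a -> is_derive x (1 : R) g b ->
  is_derive x (1 : R) (fun y => f y - g y) (a - b).
Proof. by move=> df dg; exact: (is_deriveB df dg). Qed.

Lemma is_derive1M f g x a b : is_derive x (1 : R) f a -> is_derive x (1 : R) g b ->
  is_derive x (1 : R) (fun y => f y * g y) (a * g x + f x * b).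
Proof.
move=> df dg; have := is_deriveM df dg; move/is_derive_eq; apply.
by rewrite addrC; congr (_ + _); rewrite mulrC.
Qed.

Lemma is_derive1Zl k f x a : is_derive x (1 : R) f a ->
  is_derive x (1 : R) (fun y => k * f y) (k * a).
Proof. by move=> df; exact: (is_deriveZ k df). Qed.

Lemma is_derive1N f x a : is_derive x (1 : R) f a ->
  is_derive x (1 : R) (fun y => - f y) (- a).
Proof. by move=> df; exact: is_deriveN. Qed.

Lemma is_derive1V f x a : f x != 0 -> is_derive x (1 : R) f a ->
  is_derive x (1 : R) (fun y => (f y)^-1) (- (f x) ^- 2 * a).
Proof.
move=> fx0 [df <-]; apply: DeriveDef; first exact: derivableV.
by rewrite deriveV.
Qed.

Lemma is_derive1_cst k x : is_derive x (1 : R) (fun _ : R => k) 0.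
Proof. exact: is_derive_cst. Qed.

Lemma is_derive1_continuous f (df : R -> R) :
  (forall x, is_derive x (1 : R) f (df x)) -> continuous f.
Proof.
by move=> Hd x; apply/differentiable_continuous/derivable1_diffP; exact: @ex_derive.
Qed.

Lemma derivable_continuous f : (forall x, derivable f x 1) -> continuous f.
Proof. by move=> Hd x; apply/differentiable_continuous/derivable1_diffP. Qed.

Lemma derive_ge0_le f (df : R -> R) a b : a <= b ->
  (forall x, is_derive x (1 : R) f (df x)) ->
  (forall x, a < x < b -> 0 <= df x) -> f a <= f b.
Proof.
rewrite le_eqVlt => /predU1P[->//|ab] Hd df0.
have cf := is_derive1_continuous Hd.
have [|c + H] := MVT ab (fun x _ => Hd x); first exact: continuous_subspaceT.
rewrite in_itv/= => cab.
by rewrite -subr_ge0 H mulr_ge0 ?df0// subr_ge0 ltW.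
Qed.

Lemma derive_eq0_eq f (df : R -> R) a b : a <= b ->
  (forall x, is_derive x (1 : R) f (df x)) ->
  (forall x, a < x < b -> df x = 0) -> f a = f b.
Proof.
move=> ab Hd df0; apply/eqP; rewrite eq_le (derive_ge0_le ab Hd)/=; last first.
  by move=> x /df0 ->.
rewrite -lerN2; apply: (@derive_ge0_le (fun x => - f x) (fun x => - df x)) => //.
by move=> x /df0 ->; rewrite oppr0.
Qed.

(** Its square is a C^1 function with explicit derivative; it is the building
block both of the primitive of |y| and of the compactly supported bumps. *)
Definition pospart x : R := Num.max 0 x.

Lemma pospart_ge0 x : 0 <= pospart x.
Proof. by rewrite /pospart le_max lexx. Qed.

Lemma pospart_pos x : 0 <= x -> pospart x = x.
Proof. by move=> x0; rewrite /pospart max_r. Qed.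

Lemma pospart_neg x : x <= 0 -> pospart x = 0.
Proof. by move=> x0; rewrite /pospart max_l. Qed.

(** Squaring removes the corner of [pospart] at 0: there the difference quotient
is at most |h|. *)
Lemma is_derive1_sqr_pospart x :
  is_derive x (1 : R) (fun y => pospart y ^+ 2) (2 * pospart x).
Proof.
have [x0|x0|<-] := ltgtP 0 x.
- rewrite (pospart_pos (ltW x0)).
  apply: (@near_eq_is_derive _ _ _ (fun y : R => y * y)).
    by near=> y; rewrite pospart_pos// ltW//; near: y; exact: lt_nbhsr.
  have := @is_derive1M id id x 1 1 (is_derive_id _ _) (is_derive_id _ _).
  by move/is_derive_eq; apply; rewrite /=; ring.
- rewrite (pospart_neg (ltW x0)).
  apply: (@near_eq_is_derive _ _ _ (fun y : R => 0)).
    by near=> y; rewrite pospart_neg ?expr0n// ltW//; near: y; exact: lt_nbhsl.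
  by rewrite mulr0; exact: is_derive1_cst.
- rewrite pospart_pos// mulr0.
  have cv : h^-1 *: ((fun y : R => pospart y ^+ 2) (h *: (1 : R) + 0) -
       (fun y : R => pospart y ^+ 2) 0) @[h --> (0 : R)^'] --> (0 : R).
    apply/cvgrPdist_le => /= e e0; near=> h.
    rewrite (pospart_pos (lexx _)) expr0n/= subr0 addr0 sub0r normrN.
    rewrite /GRing.scale/= mulr1 normrM normfV normrX.
    have h0 : h != 0 by near: h; exact: nbhs_dnbhs_neq.
    have he : `|h| <= e.
      by near: h; apply: dnbhs0_le.
    have m : `|pospart h| <= `|h|.
      have [h0'|/ltW h0'] := leP 0 h; first by rewrite pospart_pos.
      by rewrite pospart_neg// normr0 normr_ge0.
    rewrite mulrC ler_pdivrMr ?normr_gt0// expr2.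
    by apply: ler_pM => //; exact: le_trans he.
  apply: DeriveDef; first by apply/cvg_ex; exists 0.
  exact: cvg_lim cv.
Unshelve. all: by end_near. Qed.

End calculus.

Section torus_integral.
Context {R : realType}.
Implicit Types (f g F G : R -> R).
Local Notation T := (measurableTypeR R).
Local Notation mu := (@lebesgue_measure R).
Local Notation tor := (torus_measure R).

Lemma measurable_torus_itv : measurable (`[0, 1]%classic : set T).
Proof. exact: measurable_itv. Qed.

Lemma torus_measureE (A : set T) : tor A = mu (A `&` `[0, 1]).
Proof. by []. Qed.

Lemma torus_measureT : tor setT = 1%E.
Proof.
by rewrite torus_measureE setTI lebesgue_measure_itv/= lte_fin ltr01 oppr0 adde0.
Qed.

(** The torus measure does not charge the complement of [0, 1], so a property
can be checked there only. *)
Lemma torus_ae (P : T -> Prop) : (forall x, 0 <= x <= 1 -> P x) ->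
  {ae tor, forall x, P x}.
Proof.
move=> HP; exists (~` `[0, 1]%classic); split.
- by apply: measurableC; exact: measurable_torus_itv.
- by rewrite torus_measureE setICl measure0.
- move=> x /= nP; rewrite in_itv/= => x01; exact/nP/HP.
Qed.

Lemma integral_torus (f : R -> \bar R) : measurable_fun [set: R] f ->
  (\int[tor]_x f x = \int[mu]_(x in `[0%R, 1%R]) f x)%E.
Proof.
move=> mf.
rewrite -(@eq_measure_integral _ _ _ (`[0, 1]%classic : set T) mu tor); last first.
  move=> A mA A01; rewrite torus_measureE setIidl//.
rewrite [RHS]integral_mkcond; apply: ae_eq_integral => //.
  apply/(measurable_restrictT _ _).1; first exact: measurable_torus_itv.
  exact: measurable_funS mf.
apply: torus_ae => x x01 _; rewrite patchE mem_set//.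
Qed.

Lemma integrable_continuous_itv f a b : continuous f ->
  mu.-integrable `[a, b] (EFin \o f).
Proof.
move=> cf; apply: continuous_compact_integrable; first exact: segment_compact.
exact: continuous_subspaceT.
Qed.

Lemma torus_integrable f : continuous f -> tor.-integrable setT (EFin \o f).
Proof.
move=> cf; apply/integrableP; split.
  by apply/measurable_EFinP; exact: continuous_measurable_fun.
rewrite (@integral_torus (fun x => `|(EFin \o f) x|%E)); last first.
  apply: measurableT_comp => //; apply/measurable_EFinP; exact: continuous_measurable_fun.
by have /integrableP[] := integrable_continuous_itv 0 1 cf.
Qed.

Lemma torus_FTC f F : continuous f -> (forall x, is_derive x (1 : R) F (f x)) ->
  (\int[tor]_x (f x)%:E = (F 1 - F 0)%:E)%E.
Proof.
move=> cf dF.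
have cF := is_derive1_continuous dF.
rewrite integral_torus; last first.
  by apply/measurable_EFinP; exact: continuous_measurable_fun.
rewrite (@continuous_FTC2 _ f F 0 1)//.
- exact: continuous_subspaceT.
- by split => //; [exact/cvg_at_right_filter/cF|exact/cvg_at_left_filter/cF].
- by move=> x _; rewrite derive1E; exact: derive_val.
Qed.

Lemma torus_RFTC f F : continuous f -> (forall x, is_derive x (1 : R) F (f x)) ->
  \int[tor]_x f x = F 1 - F 0.
Proof. by move=> cf dF; rewrite /Rintegral (torus_FTC cf dF). Qed.

(** The primitive is needed on the whole line, since the primitive of a periodic
function of mean zero is used as a periodic function.  Near a point x it differs
by a constant from the integral from a base point lying to the left of x and
of 0. *)
Lemma antiderivative f : continuous f ->
  exists F : R -> R, forall x, is_derive x (1 : R) F (f x).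
Proof.
move=> cf.
pose F x := if 0 <= x then \int[mu]_(t in `[0, x]) f t
            else - \int[mu]_(t in `[x, 0]) f t.
exists F => x.
pose a : R := - (`|x| + 1); pose u : R := `|x| + 1.
have ax : a < x by rewrite /a; have := ler_norm (- x); rewrite normrN; lra.
have xu : x < u by rewrite /u; have := ler_norm x; lra.
have a0 : a <= 0 by rewrite /a; have := normr_ge0 x; lra.
pose G y := \int[mu]_(t in `[a, y]) f t.
have [dG GE] := continuous_FTC1_closed xu (integrable_continuous_itv a u cf) ax (cf x).
have FE : \near x, G x - G 0 = F x.
  near=> y.
  have ay : a <= y by apply: ltW; near: y; exact: lt_nbhsr.
  rewrite /G /F; case: ifPn => [y0|].
    rewrite Rintegral_itvB ?bnd_simp//; last exact: integrable_continuous_itv.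
    rewrite Rintegral_itv_obnd_cbnd//.
    by apply: integrableS (integrable_continuous_itv 0 y cf) => //; exact: subset_itv_oc_cc.
  rewrite -ltNge => y0.
  rewrite -[LHS]opprK opprB Rintegral_itvB ?bnd_simp//; [|exact: integrable_continuous_itv|exact: ltW].
  rewrite Rintegral_itv_obnd_cbnd//.
  by apply: integrableS (integrable_continuous_itv y 0 cf) => //; exact: subset_itv_oc_cc.
apply: (near_eq_is_derive FE).
have dGx : is_derive x (1 : R) G (f x) by rewrite -GE derive1E; exact: derivableP.
by rewrite -[f x]subr0; exact: (is_derive1B dGx (is_derive1_cst _ _)).
Unshelve. all: by end_near. Qed.

End torus_integral.

(** * Uniform density of smooth periodic functions *)

Section periodic_functions.
Context {R : realType}.
Implicit Types (f g : R -> R) (x y : R).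

Lemma periodic_int f : periodic f 1 -> forall (k : int) x, f (x + k%:~R) = f x.
Proof.
move=> pf [] n x; first by rewrite -(periodicn pf n x).
by rewrite NegzE mulrNz -(periodicn pf n.+1) subrK.
Qed.

Lemma bounded_periodic f : periodic f 1 -> continuous f ->
  exists2 M, 0 < M & forall x, `|f x| <= M.
Proof.
move=> pf cf.
have [|c _ Hc] := @EVT_max _ (fun x => `|f x|) _ _ (@ler01 R).
  apply: continuous_subspaceT => x.
  by apply: continuous_comp; [exact: cf|exact: norm_continuous].
exists (`|f c| + 1) => [|x]; first by rewrite ltr_wpDl.
rewrite -(subrK (Num.floor x)%:~R x) periodic_int//.
apply: le_trans (Hc _ _) _; last by rewrite lerDl.
have /andP[h1 h2] := floor_itv x; rewrite in_itv/= subr_ge0 h1/=.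
by move: h2; rewrite intrD => /ltW; rewrite lerBlDl.
Qed.

(** Compactness of [0, 1] makes the modulus of continuity uniform over one
period. *)
Lemma periodic_unif_continuous f (e : R) : periodic f 1 -> continuous f -> 0 < e ->
  exists2 d, 0 < d & forall x h, `|h| < d -> `|f (x + h) - f x| <= e.
Proof.
move=> pf cf e0.
have cov := (@compact_near_coveringP _ (`[0, 1]%classic : set R)).1 (@segment_compact _ _ _).
have [] := cov _ (nbhs (0 : R)) (fun h x => `|f (x + h) - f x| <= e).
  move=> x _.
  have e20 : 0 < e / 2 by rewrite divr_gt0.
  have /cvgrPdist_le /(_ _ e20) Hx := cf x.
  have cs : (fun z : R * R => f (z.1 + z.2)) @ (x, 0) --> f x.
    rewrite -[X in _ --> f X](addr0 x).
    by apply: (@continuous_comp _ _ _ (fun z : R * R => z.1 + z.2)); [exact: add_continuous|exact: cf].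
  have /cvgrPdist_le /(_ _ e20) Hs := cs.
  have Hx' : \forall x' \near x & h \near nbhs (0 : R), `|f x - f x'| <= e / 2.
    exists ([set y | `|f x - f y| <= e / 2], setT) => /=; first by split => //; exact: filterT.
    by move=> [y h] [].
  apply: filterS2 Hx' Hs => -[y h] /= h1 h2.
  rewrite (_ : f (y + h) - f y = (f x - f y) - (f x - f (y + h))); last by ring.
  by apply: le_trans (ler_normB _ _) _; lra.
move=> d /= d0 Hd; exists d => // x h hd.
rewrite -(subrK (Num.floor x)%:~R x) addrAC !periodic_int//.
apply: (Hd h); first by rewrite /= sub0r normrN.
have /andP[h1 h2] := floor_itv x; rewrite /= in_itv/= subr_ge0 h1/=.
by move: h2; rewrite intrD => /ltW; rewrite lerBlDl.
Qed.

End periodic_functions.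

Section elementary_functions.
Context {R : realType}.
Implicit Types (f g : R -> R) (x y c : R).

(** A class of functions that is visibly stable under differentiation, so that
all its members are smooth, and that still contains the quotients of
trigonometric sums used for smoothing. *)
Inductive elementary : (R -> R) -> Prop :=
| elementary_cst c : elementary (fun _ => c)
| elementary_cos y : elementary (fun x => cos (2 * pi * (x - y)))
| elementary_sin y : elementary (fun x => sin (2 * pi * (x - y)))
| elementaryD f g : elementary f -> elementary g -> elementary (fun x => f x + g x)
| elementaryM f g : elementary f -> elementary g -> elementary (fun x => f x * g x)
| elementaryV f : (forall x, f x != 0) -> elementary f ->
    elementary (fun x => (f x)^-1).

Lemma is_derive_affine (a y x : R) : is_derive x (1 : R) (fun x => a * (x - y)) a.
Proof.
have := is_derive1Zl a (is_derive1B (is_derive_id x (1 : R)) (is_derive1_cst y x)).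
by move/is_derive_eq; apply; rewrite subr0 mulr1.
Qed.

Lemma elementary_derive f : elementary f ->
  exists2 df, elementary df & forall x, is_derive x (1 : R) f (df x).
Proof.
elim=> {f} [c|y|y|f g _ [df edf Hf] _ [dg edg Hg]|f g ef [df edf Hf] eg [dg edg Hg]|f f0 ef [df edf Hf]].
- by exists (fun=> 0) => [|x]; [exact: elementary_cst|exact: is_derive1_cst].
- exists (fun x => (- (2 * pi)) * sin (2 * pi * (x - y))).
    by apply: elementaryM; [exact: elementary_cst|exact: elementary_sin].
  move=> x; have := is_derive1_comp (is_derive_cos _) (is_derive_affine (2 * pi) y x).
  by move/is_derive_eq; apply; ring.
- exists (fun x => (2 * pi) * cos (2 * pi * (x - y))).
    by apply: elementaryM; [exact: elementary_cst|exact: elementary_cos].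
  move=> x; have := is_derive1_comp (is_derive_sin _) (is_derive_affine (2 * pi) y x).
  by move/is_derive_eq; apply; ring.
- exists (fun x => df x + dg x); first exact: elementaryD.
  by move=> x; exact: is_derive1D.
- exists (fun x => df x * g x + f x * dg x).
    by apply: elementaryD; apply: elementaryM.
  by move=> x; exact: is_derive1M.
- exists (fun x => (-1 * ((f x)^-1 * (f x)^-1)) * df x).
    apply: elementaryM => //; apply: elementaryM; first exact: elementary_cst.
    by apply: elementaryM; exact: elementaryV.
  move=> x; have := is_derive1V (f0 x) (Hf x).
  by move/is_derive_eq; apply; rewrite mulN1r expr2 invfM.
Qed.

Lemma elementary_continuous f : elementary f -> continuous f.
Proof. by move=> /elementary_derive[df _ Hf]; exact: is_derive1_continuous Hf. Qed.

Lemma elementary_smooth f : elementary f ->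
  forall n x, derivable (derive1n n f) x 1.
Proof.
move=> ef n; elim: n f ef => [|n IH] f ef x; have [df edf Hf] := elementary_derive ef.
  exact: @ex_derive.
rewrite /derive1n iterSr -/(derive1n n _).
rewrite (_ : derive1 f = df); first exact: IH.
by apply/funext => z; rewrite derive1E; exact: derive_val.
Qed.

Lemma smooth_primitive f F : elementary f ->
  (forall x, is_derive x (1 : R) F (f x)) ->
  forall n x, derivable (derive1n n F) x 1.
Proof.
move=> ef dF [|n] x; first exact: @ex_derive.
rewrite /derive1n iterSr -/(derive1n n _).
rewrite (_ : derive1 F = f); first exact: elementary_smooth.
by apply/funext => z; rewrite derive1E; exact: derive_val.
Qed.

Lemma elementaryX f n : elementary f -> elementary (fun x => f x ^+ n).
Proof.
move=> ef; elim: n => [|n IH]; first exact: elementary_cst.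
by under eq_fun do rewrite exprS; exact: elementaryM.
Qed.

Lemma elementary_sum n (f : nat -> R -> R) : (forall j, elementary (f j)) ->
  elementary (fun x => \sum_(j < n) f j x).
Proof.
move=> ef; elim: n => [|n IH].
  by under eq_fun do rewrite big_ord0; exact: elementary_cst.
by under eq_fun do rewrite big_ord_recr; exact: elementaryD.
Qed.

End elementary_functions.

Section smoothing.
Context {R : realType}.
Implicit Types (f g : R -> R) (x y : R).

(** This is cos^2 (pi x): it equals 1 exactly at the integers, so that its high
powers concentrate there. *)
Definition cos_kernel x : R := 2^-1 * (1 + cos (2 * pi * x)).

Lemma cos_kernel_periodic : periodic cos_kernel 1.
Proof.
move=> x; rewrite /cos_kernel (_ : 2 * pi * (x + 1) = 2 * pi * x + pi *+ 2) ?cosD2pi//.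
by rewrite mulrDr mulr1 mulr_natl.
Qed.

Lemma cos_kernel_ge0 x : 0 <= cos_kernel x.
Proof.
by rewrite mulr_ge0 ?invr_ge0// -lerBlDl sub0r; exact: cos_geN1.
Qed.

Lemma cos_kernelN x : cos_kernel (- x) = cos_kernel x.
Proof. by rewrite /cos_kernel mulrN cosN. Qed.

Lemma cos_kernel_norm x : cos_kernel `|x| = cos_kernel x.
Proof. by case: (ger0P x) => _ //; rewrite cos_kernelN. Qed.

Lemma cos_kernel_decr x y : 0 <= x -> x < y -> y <= 2^-1 ->
  cos_kernel y < cos_kernel x.
Proof.
move=> x0 xy y2.
have pi0 : 0 < pi :> R := pi_gt0 R.
have itv z : 0 <= z -> z <= 2^-1 -> 2 * pi * z \in `[0, pi : R].
  move=> z0 z2; rewrite in_itv/= !mulr_ge0 ?(ltW pi0)//=.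
  by rewrite mulrAC ger_pMl//; lra.
rewrite ltr_pM2l ?invr_gt0// ltrD2l ltr_cos ?ltr_pM2l ?mulr_gt0//; apply: itv => //.
  exact: ltW (lt_le_trans xy y2).
exact: ltW (le_lt_trans x0 xy).
Qed.

Lemma elementary_cos_kernel y : elementary (fun x => cos_kernel (x - y)).
Proof.
apply: elementaryM; first exact: elementary_cst.
by apply: elementaryD; [exact: elementary_cst|exact: elementary_cos].
Qed.

(** Modulo 1, either x and y are at distance less than d, or the kernel is at
most its value at distance d. *)
Lemma cos_kernel_far g (d e : R) : periodic g 1 -> 0 < d ->
  (forall x h, `|h| < d -> `|g (x + h) - g x| <= e) ->
  forall x y, `|g y - g x| <= e \/ cos_kernel (x - y) <= cos_kernel d.
Proof.
move=> pg d0 Hd x y.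
(* z below is the representative of x - y modulo 1 in [-1/2, 1/2) *)
pose k := Num.floor (x - y + 2^-1).
have /andP[k1 k2] := floor_itv (x - y + 2^-1).
rewrite intrD in k2.
pose z := x - y - k%:~R.
have [zd|dz] := ltP `|z| d.
  left; rewrite -(periodic_int pg k y) (_ : y + k%:~R = x + - z); last by rewrite /z; ring.
  by apply: Hd; rewrite normrN.
right; rewrite -(subrK k%:~R (x - y)) (periodic_int cos_kernel_periodic).
rewrite -/z -(cos_kernel_norm z).
move: dz; rewrite le_eqVlt => /predU1P[->//|dz].
apply/ltW/cos_kernel_decr => //; first exact: ltW.
rewrite ler_norml /z; rewrite -/k in k1 k2; apply/andP; split; lra.
Qed.

(** Some point of the grid of mesh 1/n is within 1/n of x modulo 1. *)
Lemma cos_kernel_near n x : (1 < n)%N ->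
  exists2 j : 'I_n, True & cos_kernel (n%:R^-1) <= cos_kernel (x - j%:R / n%:R).
Proof.
move=> n1.
have n0 : (0 : R) < n%:R by rewrite ltr0n; exact: ltn_trans n1.
pose f := x - (Num.floor x)%:~R.
have /andP[k1 k2] := floor_itv x; rewrite intrD in k2.
have f0 : 0 <= f by rewrite subr_ge0.
have f1 : f < 1 by rewrite /f ltrBlDl.
have nf0 : 0 <= n%:R * f by rewrite mulr_ge0// ltW.
have jn : (Num.trunc (n%:R * f) < n)%N.
  by rewrite truncn_lt_nat// gtr_pMr.
have /andP[j1 j2] := truncn_itv nf0.
exists (Ordinal jn) => //=; set j := Num.trunc _ in j1 j2 *.
rewrite (_ : x - _ = f - j%:R / n%:R + (Num.floor x)%:~R); last by rewrite /f; ring.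
rewrite (periodic_int cos_kernel_periodic); apply/ltW/cos_kernel_decr.
- by rewrite subr_ge0 ler_pdivrMr// mulrC.
- by rewrite ltrBlDr -[X in X + _]mul1r -mulrDl ltr_pdivlMr// mulrC -natr1 addrC in j2 *.
- by rewrite lef_pV2 ?posrE// ler_nat.
Qed.

(** The approximant is a weighted average of the values of g on the grid of mesh
1/n, with weight the m-th power of [cos_kernel] centred at the grid point.  For
n fixed and m large, grid points at distance at least d from x have a weight
which is negligible against that of a grid point within 1/n < d of x. *)
Theorem elementary_dense g (e : R) : periodic g 1 -> continuous g -> 0 < e ->
  exists v, [/\ elementary v, periodic v 1 & forall x, `|v x - g x| <= e].
Proof.
move=> pg cg e0.
have e20 : 0 < e / 2 by rewrite divr_gt0.
have [d' d'0 Hd'] := periodic_unif_continuous pg cg e20.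
(* the kernel decreases on [0, 1/2] only *)
pose d := Num.min d' 2^-1.
have d0 : 0 < d by rewrite lt_min d'0 invr_gt0/=.
have d2 : d <= 2^-1 by rewrite ge_min lexx orbT.
have Hd x h : `|h| < d -> `|g (x + h) - g x| <= e / 2.
  by move=> hd; apply: Hd'; apply: lt_le_trans hd _; rewrite ge_min lexx.
have [G G0 HG] := bounded_periodic pg cg.
pose n := (Num.trunc d^-1).+1.+1.
have n0 : (0 : R) < n%:R by rewrite ltr0n.
have nd : n%:R^-1 < d.
  rewrite -[ltRHS]invrK ltf_pV2 ?posrE ?invr_gt0//.
  have /andP[_] := truncn_itv (ltW (eqbRL (invr_gt0 d) d0)).
  by move/lt_trans; apply; rewrite ltr_nat.
have n1 : (1 < n)%N by [].
pose k1 := cos_kernel d; pose k2 := cos_kernel n%:R^-1.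
have k12 : k1 < k2.
  by apply: cos_kernel_decr => //; rewrite invr_ge0 ltW.
have k10 : 0 <= k1 := cos_kernel_ge0 d.
have k20 : 0 < k2 := le_lt_trans k10 k12.
have [m Hm] : exists m : nat, (2 * G * n%:R) * (k1 / k2) ^+ m <= e / 2.
  have r1 : `|k1 / k2| < 1.
    by rewrite ger0_norm ?divr_ge0 ?(ltW k20)// ltr_pdivrMr// mul1r.
  have /cvgrPdist_le /(_ _ e20) [m _ Hm] := cvg_geometric (2 * G * n%:R) r1.
  exists m; have := Hm m (leqnn m); rewrite /geometric/= sub0r normrN.
  exact/le_trans/ler_norm.
pose wt (j : nat) x := cos_kernel (x - j%:R / n%:R) ^+ m.
pose S x := \sum_(j < n) wt j x.
have wt0 j x : 0 <= wt j x by rewrite exprn_ge0// cos_kernel_ge0.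
have S2 x : k2 ^+ m <= S x.
  have [j _ Hj] := cos_kernel_near x n1.
  rewrite /S (bigD1 j)//=; apply: ler_wpDr; first exact: sumr_ge0.
  by apply: lerXn2r; rewrite ?nnegrE ?cos_kernel_ge0.
have S0 x : 0 < S x by apply: lt_le_trans (S2 x); rewrite exprn_gt0.
have ewt j : elementary (wt j) by apply: elementaryX; exact: elementary_cos_kernel.
have pwt j : periodic (wt j) 1.
  by move=> x; rewrite /wt addrAC cos_kernel_periodic.
exists (fun x => (\sum_(j < n) g (j%:R / n%:R) * wt j x) * (S x)^-1); split.
- apply: elementaryM.
    apply: (@elementary_sum _ n (fun j x => g (j%:R / n%:R) * wt j x)) => j.
    by apply: elementaryM => //; exact: elementary_cst.
  apply: elementaryV => [x|]; first by rewrite gt_eqF.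
  exact: elementary_sum.
- move=> x; rewrite /S; congr (_ * _^-1); apply: eq_bigr => j _; by rewrite pwt.
move=> x.
rewrite -[g x](mulfK (lt0r_neq0 (S0 x))) -mulrBl {1}/S mulr_sumr -sumrB.
rewrite normrM normfV (gtr0_norm (S0 x)) ler_pdivrMr//.
apply: le_trans (ler_norm_sum _ _ _) _.
have term (j : 'I_n) : `|g (j%:R / n%:R) * wt j x - g x * wt j x| <=
    e / 2 * wt j x + 2 * G * k1 ^+ m.
  rewrite -mulrBl normrM (ger0_norm (wt0 _ _)).
  have [H|H] := cos_kernel_far pg d0 Hd x (j%:R / n%:R).
    apply: ler_wpDr; first by rewrite !mulr_ge0 ?exprn_ge0// ltW.
    exact: ler_wpM2r.
  apply: ler_wpDl; first by rewrite mulr_ge0// ltW.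
  apply: ler_pM => //; last by apply: lerXn2r; rewrite ?nnegrE ?cos_kernel_ge0.
  by apply: le_trans (ler_normB _ _) _; have := HG x; have := HG (j%:R / n%:R); lra.
apply: le_trans (ler_sum _ (fun j _ => term j)) _.
rewrite big_split/= -mulr_sumr -/(S x) sumr_const card_ord -[X in _ + X]mulr_natr.
have -> : 2 * G * k1 ^+ m * n%:R = (2 * G * n%:R) * (k1 / k2) ^+ m * k2 ^+ m.
  by rewrite expr_div_n -[RHS]mulrA divfK ?expf_neq0 ?gt_eqF// mulrAC.
have : 2 * G * n%:R * (k1 / k2) ^+ m * k2 ^+ m <= e / 2 * S x.
  apply: ler_pM => //; last by rewrite exprn_ge0// ltW.
  by rewrite mulr_ge0 ?exprn_ge0 ?divr_ge0 ?(ltW k20)// !mulr_ge0 ?ltW.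
lra.
Qed.

End smoothing.

(** * Primitives of functions with few sign changes *)

Section alternation.
Context {R : realType}.
Implicit Types (x y a b : R).

(** This is y |y| / 2, the primitive of |y|. *)
Definition signed_sqr y : R := 2^-1 * (pospart y ^+ 2 - pospart (- y) ^+ 2).

Lemma is_derive1_signed_sqr y : is_derive y (1 : R) signed_sqr `|y|.
Proof.
have d1 := is_derive1_sqr_pospart y.
have d2 := is_derive1_comp (is_derive1_sqr_pospart (- y)) (is_derive1N (is_derive_id y (1 : R))).
have := is_derive1Zl 2^-1 (is_derive1B d1 d2).
move/is_derive_eq; apply.
have [y0|/ltW y0] := leP 0 y.
  by rewrite (pospart_pos y0) pospart_neg ?oppr_le0// ger0_norm//; lra.
by rewrite (pospart_neg y0) pospart_pos ?oppr_ge0// ler0_norm//; lra.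
Qed.

(** The extreme case is x = - y, where the increment of y |y| / 2 is y^2. *)
Lemma signed_sqr_increment x y : x <= y ->
  (y - x) ^+ 2 / 4 <= signed_sqr y - signed_sqr x.
Proof.
move=> xy; rewrite /signed_sqr.
have [x0|/ltW x0] := leP 0 x; have [y0|/ltW y0] := leP 0 y.
- rewrite !(pospart_pos x0) !(pospart_pos y0) !pospart_neg ?oppr_le0//; nra.
- have -> : y = x by lra.
  by rewrite !subrr expr0n/= mul0r.
- rewrite (pospart_neg x0) (pospart_pos y0) [pospart (- y)]pospart_neg ?oppr_le0//.
  by rewrite [pospart (- x)]pospart_pos ?oppr_ge0//; have := sqr_ge0 (x + y); nra.
- rewrite (pospart_neg x0) (pospart_neg y0) !pospart_pos ?oppr_ge0//; nra.
Qed.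

Variables phi Phi Q M : R -> R.
Hypothesis cphi : continuous phi.
Hypothesis dPhi : forall x, is_derive x (1 : R) Phi (phi x).
Hypothesis dQ : forall x, is_derive x (1 : R) Q (`|Phi x| * `|phi x|).
Hypothesis dM : forall x, is_derive x (1 : R) M `|phi x|.

(** On an interval where phi has constant sign, Q increases like the composite of
[signed_sqr] with Phi, up to the sign, and M like Phi. *)
Lemma signed_piece (sg a b : R) : `|sg| = 1 -> a <= b ->
  (forall x, a < x < b -> sg * phi x <= 0) ->
  (M b - M a) ^+ 2 / 4 <= Q b - Q a.
Proof.
move=> sg1 ab sgphi.
have phiE x : a < x < b -> `|phi x| = - (sg * phi x).
  by move=> /sgphi H; rewrite -(ler0_norm H) normrM sg1 mul1r.
have sg2 : sg = 1 \/ sg = -1.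
  by move/eqP: sg1; rewrite eqr_norml ler01 andbT => /orP[] /eqP; [left|right].
have dMP x := is_derive1D (dM x) (is_derive1Zl sg (dPhi x)).
have MPhi : M a + sg * Phi a = M b + sg * Phi b.
  by apply: (derive_eq0_eq ab dMP) => x /phiE ->; rewrite addNr.
have dF x := is_derive1_comp (is_derive1_signed_sqr (Phi x)) (dPhi x).
have dQP x := is_derive1D (dQ x) (is_derive1Zl sg (dF x)).
have QF : Q a + sg * signed_sqr (Phi a) = Q b + sg * signed_sqr (Phi b).
  by apply: (derive_eq0_eq ab dQP) => x /phiE ->; rewrite /=; ring.
have Mab : M a <= M b by apply: (derive_ge0_le ab dM) => x _; exact: normr_ge0.
have [sgE|sgE] := sg2; rewrite sgE in MPhi QF.
- have PP : Phi b <= Phi a by lra.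
  have := signed_sqr_increment PP.
  rewrite (_ : Phi a - Phi b = M b - M a); last by lra.
  lra.
- have PP : Phi a <= Phi b by lra.
  have := signed_sqr_increment PP.
  rewrite (_ : Phi b - Phi a = M b - M a); last by lra.
  lra.
Qed.

(** Points on a segment, with a prescribed sign at the first one: unlike cyclic
sign changes, such sequences can be extended at their left end, which is what
the induction on their length needs.  Only the first K values of z matter. *)
Definition alternates (sg : R) (K : nat) a b := exists z : nat -> R,
  [/\ forall i, (i < K)%N -> a <= z i <= b,
      forall i, (i.+1 < K)%N -> z i < z i.+1 &
      forall i, (i < K)%N -> 0 < sg * (-1) ^+ i * phi (z i)].

(** The Cauchy-Schwarz inequality for one new term against k old ones. *)
Lemma sqr_sum_le (k u v : R) : 0 < k ->
  (u + v) ^+ 2 / (4 * (k + 1)) <= u ^+ 2 / 4 + v ^+ 2 / (4 * k).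
Proof.
move=> k0.
rewrite -subr_ge0 (_ : _ - _ = (k * u - v) ^+ 2 / (4 * k * (k + 1))); last first.
  by field; rewrite !gt_eqF//; lra.
by rewrite divr_ge0 ?sqr_ge0// !mulr_ge0//; lra.
Qed.

(** Induction on the length of the forbidden sequences.  The segment is cut at
the infimum t of the points where phi has sign sg.  To the left of t a single
piece suffices.  To the right of t the sequences starting with the opposite sign
are shorter by one: a point of sign sg can be found between t and the first point
of such a sequence, and put in front of it. *)
Lemma few_alternations K : forall (sg a b : R), `|sg| = 1 -> a <= b ->
  ~ alternates sg K.+1 a b ->
  (M b - M a) ^+ 2 / (4 * K.+1%:R) <= Q b - Q a.
Proof.
elim: K => [|K IH] sg a b sg1 ab Hn.
  rewrite mulr1; apply: (signed_piece sg1 ab) => x /andP[/ltW ax /ltW xb].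
  rewrite leNgt; apply/negP => phix; apply: Hn; exists (fun=> x); split => //.
    by move=> i _; rewrite ax.
  by case => // _; rewrite mulr1.
have [[x0 [x0ab x0p]]|none] := pselect (exists x, a <= x <= b /\ 0 < sg * phi x); last first.
  have H : (M b - M a) ^+ 2 / 4 <= Q b - Q a.
    apply: (signed_piece sg1 ab) => x /andP[/ltW ax /ltW xb].
    rewrite leNgt; apply/negP => phix; apply: none; exists x; by rewrite ax.
  apply: le_trans H; rewrite ler_wpM2l ?sqr_ge0// lef_pV2 ?posrE//.
  by rewrite ler_peMr// ler1n.
pose E := [set x | a <= x <= b /\ 0 < sg * phi x].
have E0 : E !=set0 by exists x0.
have lbE : has_lbound E by exists a => x [/andP[]].
have infE : has_inf E by [].
pose t := inf E.
have at_ : a <= t by apply: lb_le_inf => // x [/andP[]].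
have tx0 : t <= x0 by apply: ge_inf.
have tb : t <= b by apply: le_trans tx0 _; case/andP: x0ab.
have L : (M t - M a) ^+ 2 / 4 <= Q t - Q a.
  apply: (signed_piece sg1 at_) => x /andP[ax xt].
  rewrite leNgt; apply/negP => phix.
  have : t <= x.
    by apply: ge_inf => //; split => //; rewrite (ltW ax) ltW// (lt_le_trans xt).
  by rewrite leNgt xt.
have Rn : ~ alternates (- sg) K.+1 t b.
  move=> [z [z1 z2 z3]].
  have z0t : t <= z 0%N by case/andP: (z1 0%N isT).
  have z0b : z 0%N <= b by case/andP: (z1 0%N isT).
  have [p [Ep pz]] : exists p, E p /\ p < z 0%N.
    move: z0t; rewrite le_eqVlt => /predU1P[tz|tz]; last first.
      have [p Ep pt] := inf_adherent (eqbRL (subr_gt0 _ _) tz) infE.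
      by exists p; split => //; move: pt; rewrite -/t addrC subrK.
    exfalso.
    have phit : sg * phi t < 0.
      by have := z3 0%N isT; rewrite -tz mulr1 mulNr oppr_gt0.
    have cs : continuous (fun x => sg * phi x).
      by move=> x; apply: cvgM; [exact: cvg_cst|exact: cphi].
    have [d /= d0 Hd] : nbhs t [set x | sg * phi x < 0].
      by apply: (cs t [set y | y < 0]); exact: lt_nbhsl.
    have [p Ep pt] := inf_adherent d0 infE.
    have tp : t <= p by exact: ge_inf.
    have := Hd p; rewrite /= ler0_norm ?subr_le0// opprB ltrBlDl => /(_ pt) /ltW.
    by case: Ep => _; rewrite ltNge => /negP.
  apply: Hn; exists (fun i => if i is j.+1 then z j else p); split.
  - case=> [_|i]; first by case: Ep.
    rewrite ltnS => /z1 /andP[h1 h2]; by rewrite (le_trans at_ h1).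
  - case=> [//|i]; rewrite ltnS; exact: z2.
  - case=> [_|i]; first by rewrite mulr1; case: Ep.
    rewrite ltnS => /z3; rewrite exprS; by rewrite mulN1r mulrN mulNr.
have := IH _ _ _ _ tb Rn; rewrite normrN => /(_ sg1) H2.
have k0 : (0 : R) < K.+1%:R by rewrite ltr0n.
have := sqr_sum_le (M t - M a) (M b - M t) k0.
rewrite natr1 (_ : M t - M a + (M b - M t) = M b - M a); last by ring.
move/le_trans; apply.
by rewrite (_ : Q b - Q a = (Q t - Q a) + (Q b - Q t)) ?lerD//; ring.
Qed.

End alternation.

(** * Lebesgue norms *)

Section exponents.
Context {R : realType}.
Local Open Scope ereal_scope.

Lemma inv_exponent (p : \bar R) : 1 <= p ->
  (fine p^-1)%:E = p^-1 /\ (0 <= fine p^-1 <= 1)%R.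
Proof.
case: p => [p||]//.
  rewrite lee_fin => p1; have p0 : (0 < p)%R by exact: lt_le_trans p1.
  rewrite inver gt_eqF//=; split => //.
  by rewrite invr_ge0 (ltW p0) invf_le1.
by move=> _; rewrite invey /= lexx ler01.
Qed.

Lemma inv_exponent_fin (p : R) : (1 <= p)%R -> fine p%:E^-1 = p^-1%R.
Proof. by move=> p1; rewrite inver gt_eqF//; exact: lt_le_trans p1. Qed.

Lemma inv_exponent_y : fine (+oo : \bar R)^-1 = 0%R.
Proof. by rewrite invey. Qed.

End exponents.

Section lebesgue_norms.
Context d (T : measurableType d) (R : realType).
Local Open Scope ereal_scope.
Variable mu : {measure set T -> \bar R}.
Implicit Types (f g : T -> R) (p q r : \bar R).
Local Notation "'N_ p [ f ]" := ('N[mu]_p[EFin \o f]).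

Lemma LnormE f (p : R) :
  'N_p%:E[f] = (\int[mu]_x ((`|f x| `^ p)%R)%:E) `^ p^-1.
Proof. by rewrite unlock. Qed.

Lemma measurable_normr_powR f (p : R) : measurable_fun [set: T] f ->
  measurable_fun [set: T] (fun x => `|f x| `^ p)%R.
Proof.
move=> mf; apply: (@measurableT_comp _ _ _ _ _ _ (fun y : R => y `^ p)%R).
  exact: measurable_powR.
exact: measurableT_comp.
Qed.

Lemma poweR_mono (x y : \bar R) (e : R) : (0 <= e)%R -> 0 <= x -> x <= y -> x `^ e <= y `^ e.
Proof.
move=> e0 x0 xy; apply: gt0_ler_poweR => //; rewrite in_itv/= leey andbT//.
exact: le_trans xy.
Qed.

(** For p = +oo the exponent of the measure is 0, and the bound is M. *)
Lemma Lnorm_le_support f (D : set T) (M : R) p : 1 <= p ->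
  measurable_fun [set: T] f -> measurable D -> mu D < +oo -> (0 <= M)%R ->
  (forall x, `|f x| <= M)%R -> (forall x, ~ D x -> f x = 0%R) ->
  'N_p[f] <= (M * (fine (mu D)) `^ (fine p^-1))%:E.
Proof.
move=> p1 mf mD Dfin M0 fM f0.
case: p p1 => [p||]//.
  rewrite lee_fin => p1; have p0 : (0 < p)%R by exact: lt_le_trans p1.
  rewrite LnormE inv_exponent_fin//.
  have H : \int[mu]_x ((`|f x| `^ p)%R)%:E <= ((M `^ p)%R)%:E * mu D.
    rewrite (_ : _ * _ = \int[mu]_x ((cst ((M `^ p)%R)%:E) \_ D) x); last first.
      by rewrite -integral_mkcond integral_cst.
    apply: ge0_le_integral => //.
    - by apply/measurable_EFinP; exact: measurable_normr_powR.
    - by apply/(measurable_restrictT _ _).1.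
    - move=> x _; rewrite patchE; case: ifPn => [xD|].
        by rewrite lee_fin ge0_ler_powR ?nnegrE ?(ltW p0).
      by rewrite notin_setE => /f0 ->; rewrite normr0 powR0// gt_eqF.
  apply: le_trans (poweR_mono _ _ H) _; first by rewrite invr_ge0 ltW.
    by apply: integral_ge0 => x _; rewrite lee_fin powR_ge0.
  rewrite poweRM ?lee_fin ?powR_ge0// poweR_EFin -powRrM mulfV ?gt_eqF// powRr1//.
  by rewrite -[in leLHS](fineK (_ : mu D \is a fin_num)) ?poweR_EFin ?EFinM// ge0_fin_numE.
move=> _; rewrite invey/= powRr0 mulr1 unlock; case: ifPn => _; last by rewrite lee_fin.
by apply/ess_supP; apply: nearW => x; rewrite /= lee_fin.
Qed.

Lemma Lnorm_ge_support f (D : set T) (k : R) p : 1 <= p ->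
  measurable_fun [set: T] f -> measurable D -> mu D < +oo -> 0 < mu D -> (0 <= k)%R ->
  (forall x, D x -> k <= `|f x|)%R ->
  (k * (fine (mu D)) `^ (fine p^-1))%:E <= 'N_p[f].
Proof.
move=> p1 mf mD Dfin D0 k0 fk.
case: p p1 => [p||]//.
  rewrite lee_fin => p1; have p0 : (0 < p)%R by exact: lt_le_trans p1.
  rewrite LnormE inv_exponent_fin//.
  have H : ((k `^ p)%R)%:E * mu D <= \int[mu]_x ((`|f x| `^ p)%R)%:E.
    rewrite (_ : _ * _ = \int[mu]_x ((cst ((k `^ p)%R)%:E) \_ D) x); last first.
      by rewrite -integral_mkcond integral_cst.
    apply: ge0_le_integral => //.
    - by move=> x _; rewrite patchE; case: ifPn => // _; rewrite lee_fin powR_ge0.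
    - by apply/(measurable_restrictT _ _).1.
    - by apply/measurable_EFinP; exact: measurable_normr_powR.
    - move=> x _; rewrite patchE; case: ifPn => [|_]; last by rewrite lee_fin powR_ge0.
      by rewrite inE => xD; rewrite lee_fin ge0_ler_powR ?nnegrE ?(ltW p0)//; exact: fk.
  apply: le_trans (poweR_mono _ _ H); last 2 first.
  - by rewrite invr_ge0 ltW.
  - by rewrite mule_ge0// lee_fin powR_ge0.
  rewrite poweRM ?lee_fin ?powR_ge0// poweR_EFin -powRrM mulfV ?gt_eqF// powRr1//.
  by rewrite -[in leRHS](fineK (_ : mu D \is a fin_num)) ?poweR_EFin ?EFinM// ge0_fin_numE.
move=> _; rewrite invey/= powRr0 mulr1 unlock ifT; last first.
  by apply: lt_le_trans D0 _; apply: le_measure; rewrite ?inE.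
rewrite leNgt; apply/negP => Hk.
have [N [mN N0 HN]] : \forall x \ae mu, (abse \o (EFin \o f)) x <= ess_sup mu (abse \o (EFin \o f)).
  exact: ess_sup_ge.
have DN : D `<=` N.
  move=> x Dx; apply: HN => /= Hx.
  have : k%:E <= `|(f x)%:E| by rewrite lee_fin; exact: fk.
  by move=> /le_trans => /(_ _ Hx); rewrite leNgt Hk.
have : mu D <= mu N by apply: le_measure; rewrite ?inE.
by rewrite N0 leNgt D0.
Qed.

Lemma ae_le_Lnormy f : 0 < mu setT -> \forall x \ae mu, (`|f x|)%:E <= 'N_+oo[f].
Proof. by move=> mu0; rewrite unlock mu0; exact: ess_sup_ge. Qed.

(** The Hoelder inequality for the pair (s, s'), with s = 1 and s' = +oo
included. *)
Lemma hoelder_conjugate_le1 f g (s : R) : 0 < mu setT -> (1 <= s)%R ->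
  measurable_fun [set: T] f -> measurable_fun [set: T] g ->
  'N_(hoelder_conjugate s%:E)[g] <= 1 -> 'N_1[(f \* g)%R] <= 'N_s%:E[f].
Proof.
move=> mu0; rewrite le_eqVlt => /predU1P[<-|s1] mf mg.
  rewrite hoelder_conjugate1 => g1.
  rewrite !Lnorm1; apply: ae_ge0_le_integral => //=.
  - by apply/measurable_EFinP; apply: measurableT_comp => //; exact: measurable_funM.
  - by apply/measurable_EFinP; apply: measurableT_comp.
  apply: filterS (ae_le_Lnormy g mu0) => x Hx _.
  rewrite lee_fin normrM ler_piMr// -lee_fin; exact: le_trans g1.
move=> g1.
have s0 : (0 < s)%R by exact: lt_trans s1.
have sE : hoelder_conjugate s%:E = (s / (s - 1))%:E.
  by rewrite /hoelder_conjugate/= gt_eqF// inver subr_eq0 gt_eqF.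
rewrite sE in g1.
have := hoelder mu mf mg s0 (_ : 0 < s / (s - 1))%R; rewrite divr_gt0 ?subr_gt0//.
move=> /(_ isT); have -> : (s^-1 + (s / (s - 1))^-1 = 1)%R.
  by field; rewrite subr_eq0 !gt_eqF.
move=> /(_ erefl)/le_trans; apply; rewrite -[leRHS]mule1.
by apply: lee_wpmul2l => //; exact: Lnorm_ge0.
Qed.

Hypothesis mu1 : mu setT = 1.

Let mu0 : 0 < mu setT. Proof. by rewrite mu1 lte01. Qed.

(** Monotonicity of the norms on a probability space, from Hoelder's inequality
against the constant 1. *)
Lemma Lnorm1_le f r : 1 <= r -> measurable_fun [set: T] f -> 'N_1[f] <= 'N_r[f].
Proof.
move=> + mf; case: r => [r||]//.
  rewrite lee_fin le_eqVlt => /predU1P[<-//|r1].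
  have r0 : (0 < r)%R by exact: lt_trans r1.
  have := hoelder mu mf (measurable_cst (1%R : R)) r0 (_ : 0 < r / (r - 1))%R.
  rewrite divr_gt0 ?subr_gt0// => /(_ isT).
  have -> : (r^-1 + (r / (r - 1))^-1 = 1)%R by field; rewrite subr_eq0 !gt_eqF.
  move=> /(_ erefl); rewrite (_ : (f \* cst 1)%R = f); last first.
    by apply/funext => x /=; rewrite mulr1.
  move=> /le_trans; apply.
  rewrite (_ : EFin \o cst 1%R = cst 1)// Lnorm_cst1 mu1 poweR1r mule1//.
move=> _; rewrite Lnorm1.
have := ae_le_Lnormy f mu0.
case E : ('N_+oo[f]) => [M||] H; [|exact: leey|]; last first.
  by have := Lnorm_ge0 mu +oo (EFin \o f); rewrite E.
apply: (@le_trans _ _ (\int[mu]_x M%:E)); last by rewrite integral_cst// mu1 mule1.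
apply: ae_ge0_le_integral => //=.
- by apply/measurable_EFinP; apply: measurableT_comp.
- move=> x _; have := Lnorm_ge0 mu +oo (EFin \o f); by rewrite E.
- by apply: filterS H => x Hx _.
Qed.

(** The interpolation estimates come out as bounds on the integral of |f|^p
normalized by B ^ p; this takes the p-th root. *)
Lemma Lnorm_root_le f (p B L e : R) : (0 < p)%R -> (0 < B)%R -> (0 < L)%R ->
  \int[mu]_x ((`|f x| `^ p)%R)%:E <= (B `^ p * L `^ e)%:E ->
  'N_p%:E[f] <= (B * L `^ (e / p))%:E.
Proof.
move=> p0 B0 L0 H; rewrite LnormE.
apply: le_trans (poweR_mono _ _ H) _; first by rewrite invr_ge0 ltW.
  by apply: integral_ge0 => x _; rewrite lee_fin powR_ge0.
by rewrite poweR_EFin lee_fin powRM ?powR_ge0// -!powRrM mulfV ?gt_eqF// powRr1// ltW.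
Qed.

(** Log-convexity of the norm in the inverse exponent, between the exponents 1
and r.  It is written relative to B = |f|_1, so that a product of several such
bounds only involves the sum of the exponents of A / B >= 1. *)
Lemma Lnorm_interpolation f p r (A B : R) : 1 <= p -> 1 <= r ->
  measurable_fun [set: T] f -> (0 < B)%R ->
  'N_1[f] = B%:E -> 'N_r[f] = A%:E ->
  (fine r^-1 <= fine p^-1)%R -> (fine r^-1 < 1)%R ->
  'N_p[f] <= (B * (A / B) `^ ((1 - fine p^-1) / (1 - fine r^-1)))%:E.
Proof.
move=> p1 r1 mf B0 NB NA.
have BA : (B <= A)%R by rewrite -lee_fin -NB -NA; exact: Lnorm1_le.
have A0 : (0 < A)%R by exact: lt_le_trans BA.
set L := (A / B)%R.
have L0 : (0 < L)%R by rewrite divr_gt0.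
have AE : (A = B * L)%R by rewrite /L mulrC divfK// gt_eqF.
case: p p1 => [p p1||]//; last first.
  move=> _; rewrite inv_exponent_y.
  case: r r1 NA => [r r1 _|_ NA _ _|]//.
    rewrite lee_fin in r1; have r0 : (0 < r)%R by exact: lt_le_trans r1.
    by rewrite inv_exponent_fin// leNgt invr_gt0 r0.
  by rewrite inv_exponent_y subr0 divff// powRr1 ?(ltW L0)// -AE NA.
rewrite lee_fin in p1; have p0 : (0 < p)%R by exact: lt_le_trans p1.
rewrite (inv_exponent_fin p1).
case: r r1 NA => [r r1 NA|_ NA _ _|]//; last first.
  rewrite inv_exponent_y subr0 divr1.
  rewrite (_ : 1 - p^-1 = (p - 1) / p)%R; last by field; rewrite gt_eqF.
  apply: Lnorm_root_le => //.
  apply: (@le_trans _ _ (\int[mu]_x ((A `^ (p - 1))%:E * (`|f x|)%:E))).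
    apply: ae_ge0_le_integral => //=.
    - by apply/measurable_EFinP; exact: measurable_normr_powR.
    - by move=> x _; rewrite mule_ge0// lee_fin powR_ge0.
    - by apply/measurable_EFinP; apply: measurable_funM => //; apply: measurableT_comp.
    have := ae_le_Lnormy f mu0; rewrite NA; apply: filterS => x; rewrite lee_fin => Hx _.
    rewrite -EFinM lee_fin -(mulr_powRB1 _ p0)// mulrC ler_wpM2r//.
    by rewrite ge0_ler_powR ?nnegrE ?subr_ge0// ltW.
  rewrite ge0_integralZl//=; last 2 first.
  - by apply/measurable_EFinP; apply: measurableT_comp.
  - by rewrite lee_fin powR_ge0.
  have -> : \int[mu]_x (`|f x|)%:E = B%:E by rewrite -NB Lnorm1.
  rewrite -EFinM lee_fin AE powRM ?(ltW B0) ?(ltW L0)//.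
  by rewrite mulrAC [X in (X * _)%R]mulrC (mulr_powRB1 (ltW B0) p0).
rewrite lee_fin in r1; have r0 : (0 < r)%R by exact: lt_le_trans r1.
rewrite (inv_exponent_fin r1) => pr r1'.
have {}r1 : (1 < r)%R by move: r1'; rewrite invf_lt1.
have {}pr : (p <= r)%R by move: pr; rewrite lef_pV2.
move: p1; rewrite le_eqVlt => /predU1P[p1|p1].
  by rewrite -p1 invr1 subrr mul0r powRr0 mulr1 NB.
move: pr; rewrite le_eqVlt => /predU1P[pr|pr].
  by rewrite pr divff ?powRr1 ?(ltW L0)// -?AE ?NA// subr_eq0 gt_eqF.
(* p = l r + (1 - l), so |f| ^ p = (|f| ^ r) ^ l |f| ^ (1 - l) *)
pose l := ((p - 1) / (r - 1))%R.
have l0 : (0 < l)%R by rewrite divr_gt0 ?subr_gt0.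
have l1 : (l < 1)%R by rewrite ltr_pdivrMr ?subr_gt0// mul1r ltrD2r.
have l10 : (0 < 1 - l)%R by rewrite subr_gt0.
rewrite (_ : (1 - p^-1) / (1 - r^-1) = (r * l) / p)%R; last first.
  rewrite /l; field.
  by rewrite ?subr_eq0 !gt_eqF.
have lE : (r * l + (1 - l) = p)%R by rewrite /l; field; rewrite subr_eq0 gt_eqF.
apply: Lnorm_root_le => //.
pose F x := (`|f x| `^ (r * l))%R; pose G x := (`|f x| `^ (1 - l))%R.
have mF : measurable_fun [set: T] F by exact: measurable_normr_powR.
have mG : measurable_fun [set: T] G by exact: measurable_normr_powR.
have FE x : F x = (`|f x| `^ (r * l))%R by [].
have GE x : G x = (`|f x| `^ (1 - l))%R by [].
move: F G mF mG FE GE => F G mF mG FE GE.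
have := hoelder mu mF mG (eqbRL (invr_gt0 l) l0) (eqbRL (invr_gt0 (1 - l)%R) l10).
rewrite !invrK subrKC => /(_ erefl).
rewrite Lnorm1 !LnormE !invrK.
have -> : \int[mu]_x `|(EFin \o (F \* G)%R) x| = \int[mu]_x ((`|f x| `^ p)%R)%:E.
  apply: eq_integral => x _; rewrite /= FE GE ger0_norm ?mulr_ge0 ?powR_ge0//.
  by rewrite -powRD ?lE// gt_eqF.
have NrE := poweR_Lnorm mu (EFin \o f) (lt0r_neq0 r0).
rewrite NA poweR_EFin in NrE.
have -> : \int[mu]_x ((`|F x| `^ l^-1)%R)%:E = (A `^ r)%:E.
  rewrite NrE; apply: eq_integral => x _; rewrite FE ger0_norm ?powR_ge0// -powRrM.
  by rewrite mulfK ?gt_eqF.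
have -> : \int[mu]_x ((`|G x| `^ (1 - l)^-1)%R)%:E = B%:E.
  rewrite -NB Lnorm1; apply: eq_integral => x _; rewrite GE ger0_norm ?powR_ge0// -powRrM.
  by rewrite mulfV ?gt_eqF// powRr1.
move/le_trans; apply.
rewrite !poweR_EFin -EFinM lee_fin -powRrM AE powRM ?(ltW B0) ?(ltW L0)//.
rewrite mulrAC -powRD; last by rewrite (gt_eqF B0) implybT.
by rewrite lE.
Qed.

(** By interpolation each norm on the left is at most B (A / B) ^ theta, with
B = |f|_1, A = |f|_r and theta = (1 - 1/p) / (1 - 1/r), similarly for q and t.
The condition on the exponents says exactly that the three theta sum to at most
1, so the product is at most B ^ 3 (A / B).  If r = 1 all exponents are 1. *)
Lemma Lnorm_product_le f p q t r : 1 <= p -> 1 <= q -> 1 <= t -> 1 <= r ->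
  measurable_fun [set: T] f -> 0 < 'N_1[f] -> 'N_r[f] < +oo ->
  2%:E + r^-1 <= p^-1 + q^-1 + t^-1 ->
  'N_p[f] * 'N_q[f] * 'N_t[f] <= 'N_1[f] * 'N_1[f] * 'N_r[f].
Proof.
move=> p1 q1 t1 r1 mf N10 Nr.
have [pE /andP[p0' p1']] := inv_exponent p1.
have [qE /andP[q0' q1']] := inv_exponent q1.
have [tE /andP[t0' t1']] := inv_exponent t1.
have [rE /andP[r0' r1']] := inv_exponent r1.
rewrite -pE -qE -tE -rE -!EFinD lee_fin => Hs.
have Nrfin : 'N_r[f] \is a fin_num by rewrite ge0_fin_numE ?Lnorm_ge0.
have N1fin : 'N_1[f] \is a fin_num.
  by rewrite ge0_fin_numE ?Lnorm_ge0// (le_lt_trans _ Nr)// Lnorm1_le.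
have NA : 'N_r[f] = (fine 'N_r[f])%:E by rewrite fineK.
have NB : 'N_1[f] = (fine 'N_1[f])%:E by rewrite fineK.
set A := fine _ in NA; set B := fine _ in NB.
have B0 : (0 < B)%R by rewrite -lte_fin -NB.
have BA : (B <= A)%R by rewrite -lee_fin -NB -NA; exact: Lnorm1_le.
have [r1E|r1n] := eqVneq (fine r^-1) 1%R.
  have inv1 (u : \bar R) : 1 <= u -> fine u^-1 = 1%R -> u = 1.
    move=> u1 uE; have [uE' _] := inv_exponent u1.
    by apply/eqP; rewrite -inve_eq1 -uE' uE.
  have -> : p = 1 by apply: inv1 => //; lra.
  have -> : q = 1 by apply: inv1 => //; lra.
  have -> : t = 1 by apply: inv1 => //; lra.
  by rewrite (inv1 r).
have r1lt : (fine r^-1 < 1)%R by rewrite lt_neqAle r1n.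
have I u := @Lnorm_interpolation f u r A B.
set L := (A / B)%R in I.
have L1 : (1 <= L)%R by rewrite ler_pdivlMr// mul1r.
apply: (@le_trans _ _ ((B * L `^ ((1 - fine p^-1) / (1 - fine r^-1)))%:E *
  (B * L `^ ((1 - fine q^-1) / (1 - fine r^-1)))%:E *
  (B * L `^ ((1 - fine t^-1) / (1 - fine r^-1)))%:E)).
  apply: lee_pmul; rewrite ?mule_ge0 ?Lnorm_ge0//; last by apply: I => //; lra.
  by apply: lee_pmul; rewrite ?Lnorm_ge0//; apply: I => //; lra.
have L0 : (0 < L)%R by exact: lt_le_trans L1.
rewrite NB NA -!EFinM lee_fin.
rewrite (_ : A = B * L)%R; last by rewrite /L mulrC divfK// gt_eqF.
set x := (L `^ _)%R; set y := (L `^ _)%R; set z := (L `^ _)%R.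
have -> : (B * x * (B * y) * (B * z) = B * B * B * (x * y * z))%R by ring.
rewrite [leRHS]mulrA ler_wpM2l// ?mulr_ge0 ?(ltW B0)//.
rewrite /x /y /z -!powRD ?(gt_eqF L0) ?implybT//.
rewrite -[leRHS]powRr1 ?(ltW L0)//; apply: ler_powR => //.
by rewrite -!mulrDl ler_pdivrMr ?subr_gt0// mul1r; lra.
Qed.

End lebesgue_norms.

(** * From cyclic sign changes to alternating sequences *)

Section sign_changes_theory.
Context {R : realType}.
Implicit Types (f phi : R -> R).

(** With an even number of points the last sign differs from the first one, so
the sequence also alternates cyclically; in particular its end points are not
both ends of [0, 1], where phi takes the same value. *)
Lemma alternating_has_sign_changes phi (K : nat) : periodic phi 1 ->
  ~~ odd K -> (0 < K)%N -> alternates phi 1 K 0 1 -> has_sign_changes phi K.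
Proof.
case: K => // K pphi evK _ [z [z01 zS zpos]].
have zlt i j : (i < j)%N -> (j < K.+1)%N -> z i < z j.
  elim: j => // j IH; rewrite ltnS leq_eqVlt => /predU1P[<-|ij] jK; first exact: zS.
  exact: lt_trans (IH ij (ltnW jK)) (zS _ jK).
have zle i j : (i <= j)%N -> (j < K.+1)%N -> z i <= z j.
  by rewrite leq_eqVlt => /predU1P[->//|ij] jK; exact: ltW (zlt _ _ ij jK).
have signK : (-1) ^+ K = -1 :> R.
  by rewrite -signr_odd; move: evK; rewrite /= negbK => ->; rewrite expr1.
have z0 : 0 < phi (z 0%N) by have := zpos 0%N isT; rewrite mulr1 mul1r.
have zK : phi (z K) < 0.
  by have := zpos K (ltnSn K); rewrite signK mul1r mulN1r oppr_gt0.
have zK1 : z K < z 0%N + 1.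
  rewrite ltNge; apply/negP => H.
  have /andP[a1 a2] := z01 0%N isT; have /andP[b1 b2] := z01 K (ltnSn K).
  have E : z K = z 0%N + 1 by lra.
  by move: zK; rewrite E pphi ltNge (ltW z0).
exists (fun i : 'I_K.+1 => z i); split.
- by move=> i j ij; apply: zlt.
- move=> i j; apply: le_lt_trans (zle j K _ _) _ => //; first by rewrite -ltnS.
  by apply: (lt_le_trans zK1); rewrite lerD2r zle.
- move=> i; rewrite /=; have := ltn_ord i; rewrite ltnS leq_eqVlt => /predU1P[iK|iK].
    by rewrite iK modnn; have := z0; have := zK; nra.
  rewrite modn_small ?ltnS//.
  have := zpos i (ltn_ord i); have := zpos i.+1 iK; rewrite !mul1r exprS.
  have [->|->] : (-1) ^+ i = 1 :> R \/ (-1) ^+ i = -1 :> R.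
    by rewrite -signr_odd; case: (odd i); [right|left].
  all: nra.
Qed.

Lemma has_sign_changes2 phi (x y : R) : periodic phi 1 ->
  0 < phi x -> phi y < 0 -> has_sign_changes phi 2.
Proof.
move=> pphi px py.
pose k := Num.floor (y - x).
have /andP[k1 k2] := floor_itv (y - x); rewrite intrD -/k in k1 k2.
(* the translate of y by an integer that lies in [x, x + 1) *)
pose y' := y + (- k)%:~R.
have py' : phi y' < 0 by rewrite periodic_int.
have xy : x < y'.
  rewrite lt_neqAle; apply/andP; split; last by rewrite /y' mulrNz; lra.
  by apply/eqP => E; move: py'; rewrite -E ltNge (ltW px).
have y1 : y' < x + 1 by rewrite /y' mulrNz; lra.
exists (fun i : 'I_2 => if i == 0 :> nat then x else y'); split.
- by move=> [[|[|i]] hi] [[|[|j]] hj].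
- by move=> [[|[|i]] hi] [[|[|j]] hj] //=; lra.
- by move=> [[|[|i]] hi] //=; nra.
Qed.

Lemma sign_changes_bound phi : (sign_changes phi < +oo)%E ->
  exists n : nat, (n%:R%:E <= sign_changes phi)%E /\
    forall m, has_sign_changes phi m -> (m <= n)%N.
Proof.
move=> fin.
have ub m : has_sign_changes phi m -> (m%:R%:E <= sign_changes phi)%E.
  by move=> H; apply: ereal_sup_ubound; exists m.
have h0 : has_sign_changes phi 0 by exists (fun=> 0); split => -[].
have N0 : (0 <= sign_changes phi)%E := ub _ h0.
have NE : sign_changes phi = (fine (sign_changes phi))%:E.
  by rewrite fineK// ge0_fin_numE.
have f0 : 0 <= fine (sign_changes phi) by rewrite fine_ge0.
exists (Num.trunc (fine (sign_changes phi))); split.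
  by rewrite NE lee_fin truncn_le.
by move=> m /ub; rewrite NE lee_fin truncn_ge_nat.
Qed.

(** If n bounds the numbers of cyclic sign changes, no alternating sequence
has the even length n + 1 or n + 2, and n + 2 <= 2 n as n >= 2. *)
Lemma alternation_bound phi (x y : R) : periodic phi 1 ->
  0 < phi x -> phi y < 0 -> (sign_changes phi < +oo)%E ->
  exists K : nat, ~ alternates phi 1 K.+1 0 1 /\
    (K.+1%:R%:E <= 2%:E * sign_changes phi)%E.
Proof.
move=> pphi px py fin.
have [n [nN Hn]] := sign_changes_bound fin.
have n2 : (2 <= n)%N := Hn _ (has_sign_changes2 pphi px py).
(* the even number among n + 1 and n + 2 *)
have [K [Kev nK Kn]] : exists K, [/\ ~~ odd K.+1, (n < K.+1)%N & (K.+1 <= 2 * n)%N].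
  have [no|no] := boolP (odd n).
    by exists n; rewrite /= no; split => //; rewrite mul2n -addnn -addn1 leq_add2l ltnW.
  by exists n.+1; rewrite /= no; split => //; rewrite mul2n -addnn -addn2 leq_add2l.
exists K; split.
  by move=> /(alternating_has_sign_changes pphi Kev isT) /Hn; rewrite leqNgt nK.
apply: (@le_trans _ _ (2%:E * n%:R%:E)%E); first by rewrite -EFinM lee_fin -natrM ler_nat.
by rewrite lee_pmul2l.
Qed.

Lemma sign_changes_ge2 phi (x y : R) : periodic phi 1 ->
  0 < phi x -> phi y < 0 -> (2%:E <= sign_changes phi)%E.
Proof.
move=> pphi px py; apply: ereal_sup_ubound; exists 2%N => //.
exact: has_sign_changes2 px py.
Qed.

End sign_changes_theory.

(** * A smooth test function detecting the primitive *)

Section test_function.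
Context {R : realType}.
Implicit Types (f F phi : R -> R).

Lemma periodic_primitive f F : periodic f 1 ->
  (forall x, is_derive x (1 : R) F (f x)) -> F 1 = F 0 -> periodic F 1.
Proof.
move=> pf dF F10 x.
have dS y : is_derive y (1 : R) (fun y => F (y + 1) - F y) (f (y + 1) * (1 + 0) - f y).
  have ds : is_derive y (1 : R) (fun y => y + 1) (1 + 0).
    exact: (is_derive1D (is_derive_id _ _) (is_derive1_cst _ _)).
  exact: (is_derive1B (@is_derive1_comp _ F (fun y => y + 1) y _ _ (dF (y + 1)) ds) (dF y)).
have H : F (x + 1) - F x = F (0 + 1) - F 0.
  apply: (@is_derive_0_is_cst _ (fun y => F (y + 1) - F y)) => y.
  by apply: is_derive_eq (dS y) _; rewrite pf addr0 mulr1 subrr.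
by move: H; rewrite add0r F10 subrr => /eqP; rewrite subr_eq0 => /eqP.
Qed.

(** Otherwise the nondecreasing function M would be periodic, hence constant, and
its derivative |phi| would vanish. *)
Lemma primitive_norm_gt0 phi M : periodic phi 1 -> (exists x, phi x <> 0) ->
  (forall x, is_derive x (1 : R) M `|phi x|) -> M 0 < M 1.
Proof.
move=> pphi [x0 px0] dM.
have Mle a b : a <= b -> M a <= M b.
  by move=> ab; apply: (derive_ge0_le ab dM) => x _; exact: normr_ge0.
rewrite lt_neqAle Mle// andbT; apply/eqP => M01.
have pM : periodic M 1.
  by apply: periodic_primitive dM (esym M01) => x; rewrite pphi.
have Mcst x : x0 <= x <= x0 + 1 -> M x = M x0.
  move=> /andP[h1 h2]; apply/eqP; rewrite eq_le (Mle _ _ h1) andbT -(pM x0); exact: Mle.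
apply: px0; apply/eqP; rewrite -normr_eq0; apply/eqP.
have cM x : M x = M x0.
  rewrite -(Mcst (x - (Num.floor (x - x0))%:~R)).
    by rewrite -mulrNz periodic_int.
  have /andP[k1 k2] := floor_itv (x - x0); rewrite intrD in k2.
  by apply/andP; split; lra.
have := dM x0; rewrite (_ : M = fun=> M x0); last exact/funext.
by move=> /@derive_val <-; rewrite derive_cst.
Qed.

Lemma continuous_normr f : continuous f -> continuous (fun x => `|f x|).
Proof. by move=> cf x; apply: continuous_comp; [exact: cf|exact: norm_continuous]. Qed.

Lemma continuousM_fun f F : continuous f -> continuous F -> continuous (fun x => f x * F x).
Proof. by move=> cf cF x; apply: cvgM; [exact: cf|exact: cF]. Qed.

(** The derivative of U approximates sign(Phi) |phi| up to an additive constant,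
which is invisible to Phi as Phi has mean zero (P 1 = P 0).  The sign is first
made continuous as Phi / (|Phi| + e), and the product is then smoothed within
e.  The bound on v is pointwise, so that it controls all the norms of v at
once. *)
Lemma smooth_test_function phi Phi M Q P :
  periodic phi 1 -> continuous phi -> periodic Phi 1 ->
  (forall x, is_derive x (1 : R) Phi (phi x)) ->
  (forall x, is_derive x (1 : R) M `|phi x|) ->
  (forall x, is_derive x (1 : R) Q (`|Phi x| * `|phi x|)) ->
  (forall x, is_derive x (1 : R) P (Phi x)) -> P 1 = P 0 ->
  M 0 < M 1 -> Q 0 < Q 1 ->
  exists U v : R -> R, [/\ elementary v, periodic U 1,
    forall x, is_derive x (1 : R) U (v x),
    forall x, `|v x| <= `|phi x| + 2 * (M 1 - M 0) &
    (Q 1 - Q 0) / 2 <= `|\int[torus_measure R]_x (phi x * U x)|].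
Proof.
move=> pphi cphi pPhi dPhi dM dQ dP P10 M01 Q01.
have cPhi := is_derive1_continuous dPhi.
have [L dL] := antiderivative (continuous_normr cPhi).
have L01 : L 0 <= L 1 by apply: (derive_ge0_le ler01 dL) => x _; exact: normr_ge0.
set B := M 1 - M 0; have B0 : 0 < B by rewrite subr_gt0.
set Q0 := Q 1 - Q 0; have Q00 : 0 < Q0 by rewrite subr_gt0.
set L0 := L 1 - L 0; have L00 : 0 <= L0 by rewrite subr_ge0.
(* e <= B / 2 serves the bound on v, the other one makes the error e (B + L0)
   at most half of Q0 *)
pose e := Num.min (B / 2) (Q0 / (2 * (B + L0))).
have BL : 0 < B + L0 by rewrite ltr_wpDr.
have e0 : 0 < e by rewrite lt_min !divr_gt0// mulr_gt0.
have eB : e <= B / 2 by rewrite ge_min lexx.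
have eQ : e * (B + L0) <= Q0 / 2.
  have : e <= Q0 / (2 * (B + L0)) by rewrite ge_min lexx orbT.
  by rewrite invfM mulrA ler_pdivlMr.
pose g x := Phi x * (`|Phi x| + e)^-1 * `|phi x|.
have pe x : 0 < `|Phi x| + e by rewrite ltr_wpDl.
have cg : continuous g.
  apply: continuousM_fun; last exact: continuous_normr.
  apply: continuousM_fun => //.
  move=> x; apply: cvgV; first by rewrite gt_eqF.
  by apply: cvgD; [exact: (continuous_normr cPhi)|exact: cvg_cst].
have pg : periodic g 1 by move=> x; rewrite /g pPhi pphi.
have gphi x : `|g x| <= `|phi x|.
  rewrite /g !normrM normr_id ler_piMl// normfV (gtr0_norm (pe x)).
  by rewrite ler_pdivrMr// mul1r lerDl ltW.
(* Phi ^ 2 >= (|Phi| - e) (|Phi| + e) *)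
have Phig x : `|Phi x| * `|phi x| - e * `|phi x| <= Phi x * g x.
  rewrite /g !mulrA -mulrBl ler_wpM2r// ler_pdivlMr//.
  have -> : Phi x * Phi x = `|Phi x| * `|Phi x| by rewrite -normrM ger0_norm// -expr2 sqr_ge0.
  by have := sqr_ge0 e; nra.
have [v [ev pv vg]] := elementary_dense pg cg e0.
have [V dV] := antiderivative (elementary_continuous ev).
pose mv := V 1 - V 0.
have vphi x : `|v x| <= `|phi x| + e.
  have := vg x; have := gphi x; have := ler_normD (v x - g x) (g x).
  rewrite subrK; lra.
have dMe x := is_derive1D (dM x) (is_derive1Zl e (is_derive_id x (1 : R))).
have mvB : `|mv| <= B + e.
  rewrite ler_norml /mv; apply/andP; split.
    have : M 0 + e * 0 + V 0 <= M 1 + e * 1 + V 1.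
      apply: (derive_ge0_le ler01 (fun x => is_derive1D (dMe x) (dV x))) => x _.
      by have := vphi x; have := ler_norm (- v x); rewrite normrN; lra.
    by rewrite /B; lra.
  have : M 0 + e * 0 - V 0 <= M 1 + e * 1 - V 1.
    apply: (derive_ge0_le ler01 (fun x => is_derive1B (dMe x) (dV x))) => x _.
    by have := vphi x; have := ler_norm (v x); lra.
  by rewrite /B; lra.
pose U x := V x - mv * x; pose v0 x := v x + - mv.
have dU x : is_derive x (1 : R) U (v0 x).
  have := is_derive1B (dV x) (is_derive1Zl mv (is_derive_id x (1 : R))).
  by move/is_derive_eq; apply; rewrite /v0 mulr1.
have ev0 : elementary v0 by apply: elementaryD => //; exact: elementary_cst.
have pU : periodic U 1.
  apply: (periodic_primitive _ dU); first by move=> x; rewrite /v0 pv.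
  by rewrite /U /mv; ring.
exists U, v0; split => //.
  move=> x; have := ler_normD (v x) (- mv); rewrite normrN -/(v0 x) -/B.
  have := vphi x; lra.
have cU := is_derive1_continuous dU.
have cphiU : continuous (fun x => phi x * U x) by exact: continuousM_fun.
have [W dW] := antiderivative cphiU.
rewrite (torus_RFTC cphiU dW).
have dX x := is_derive1B (is_derive1M (dPhi x) (dU x)) (dW x).
have dY x := is_derive1B (is_derive1B (dQ x) (is_derive1Zl e (is_derive1D (dM x) (dL x))))
   (is_derive1Zl mv (dP x)).
(* W is a primitive of phi U, so Phi U - W is one of Phi v0; comparing
   derivatives replaces an integration by parts *)
have H : Phi 0 * U 0 - W 0 - (Q 0 - e * (M 0 + L 0) - mv * P 0) <=
         Phi 1 * U 1 - W 1 - (Q 1 - e * (M 1 + L 1) - mv * P 1).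
  apply: (derive_ge0_le ler01 (fun x => is_derive1B (dX x) (dY x))) => x _.
  have h1 := Phig x.
  have h2 : `|Phi x * (v x - g x)| <= e * `|Phi x|.
    by rewrite normrM mulrC ler_wpM2r.
  have h3 : - (e * `|Phi x|) <= Phi x * (v x - g x).
    by move: h2; rewrite ler_norml => /andP[].
  rewrite /v0; lra.
have PU : Phi 1 * U 1 = Phi 0 * U 0 by rewrite -[1]add0r pPhi pU.
have := ler_norm (- (W 1 - W 0)); rewrite normrN PU P10 in H *.
apply: le_trans; move: eQ; rewrite /Q0 /B /L0; lra.
Qed.

End test_function.

(** * Sufficiency of the condition on the exponents *)

Section sufficiency.
Context {R : realType}.
Local Open Scope ereal_scope.
Local Notation tor := (torus_measure R).
Implicit Types (f g phi : R -> R) (p q r : \bar R).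

Lemma torus_norm_le p f g : 1 <= p ->
  continuous f -> continuous g -> (forall x, `|f x| <= `|g x|)%R ->
  torus_norm p f <= torus_norm p g.
Proof.
move=> p1 cf cg fg; rewrite /torus_norm.
have mf : measurable_fun [set: R] f by exact: continuous_measurable_fun.
have mg : measurable_fun [set: R] g by exact: continuous_measurable_fun.
case: p p1 => [p p1||]//.
  rewrite lee_fin in p1; have p0 : (0 < p)%R by exact: lt_le_trans p1.
  rewrite !LnormE; apply: poweR_mono; first by rewrite invr_ge0 ltW.
    by apply: integral_ge0 => x _; rewrite lee_fin powR_ge0.
  apply: ge0_le_integral => //.
  - by apply/measurable_EFinP; exact: measurable_normr_powR.
  - by apply/measurable_EFinP; exact: measurable_normr_powR.
  - by move=> x _; rewrite lee_fin ge0_ler_powR ?nnegrE ?(ltW p0).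
move=> _; rewrite unlock; case: ifPn => // _.
by apply: le_ess_sup; apply: nearW => x; rewrite /= lee_fin.
Qed.

Lemma torus_normZ p f (c : R) : 1 <= p -> (0 <= c)%R -> continuous f ->
  torus_norm p (fun x => c * f x)%R = c%:E * torus_norm p f.
Proof.
move=> p1 c0 cf; rewrite /torus_norm.
have mf : measurable_fun [set: R] f by exact: continuous_measurable_fun.
case: p p1 => [p p1||]//.
  rewrite lee_fin in p1; have p0 : (0 < p)%R by exact: lt_le_trans p1.
  rewrite !LnormE.
  under eq_integral do rewrite normrM (ger0_norm c0) powRM// EFinM.
  rewrite ge0_integralZl//; [|by apply/measurable_EFinP; exact: measurable_normr_powR|by rewrite lee_fin powR_ge0].
  rewrite poweRM ?lee_fin ?powR_ge0//; last by apply: integral_ge0 => x _; rewrite lee_fin powR_ge0.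
  by rewrite poweR_EFin -powRrM mulfV ?gt_eqF// powRr1.
move=> _; rewrite unlock; have -> : 0 < tor setT by rewrite torus_measureT.
rewrite -ess_supZl//; last by rewrite torus_measureT.
by congr ess_sup; apply/funext => x; rewrite /= normrM (ger0_norm c0) EFinM.
Qed.

Lemma torus_norm_bounded p f (M : R) : 1 <= p -> continuous f -> (0 <= M)%R ->
  (forall x, `|f x| <= M)%R -> torus_norm p f <= M%:E.
Proof.
move=> p1 cf M0 fM; rewrite /torus_norm.
have mf : measurable_fun [set: R] f by exact: continuous_measurable_fun.
have := @Lnorm_le_support _ _ _ tor f setT M p p1 mf measurableT.
rewrite torus_measureT => /(_ (ltry _) M0 fM).
by rewrite /= powR1 mulr1; apply=> x /(_ I).
Qed.

Lemma torus_norm_fin p f : 1 <= p -> periodic f 1%R -> continuous f ->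
  torus_norm p f < +oo.
Proof.
move=> p1 pf cf; have [M M0 HM] := bounded_periodic pf cf.
by apply: le_lt_trans (torus_norm_bounded p1 cf (ltW M0) HM) _; rewrite ltry.
Qed.

Lemma torus_norm1E f M : continuous f -> (forall x, is_derive x (1%R : R) M `|f x|%R) ->
  torus_norm 1 f = (M 1 - M 0)%:E%R.
Proof.
move=> cf dM; rewrite /torus_norm Lnorm1.
exact: (torus_FTC (continuous_normr cf) dM).
Qed.

(** If phi had constant sign, the integral of |phi| would be, up to sign, that
of phi. *)
Lemma zero_mean_signs phi : torus_continuous phi ->
  (exists x, phi x <> 0%R) -> zero_mean phi ->
  (exists x, (0 < phi x)%R) /\ (exists y, (phi y < 0)%R).
Proof.
move=> [pphi cphi] phi0.
have [M dM] := antiderivative (continuous_normr cphi).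
have M01 := primitive_norm_gt0 pphi phi0 dM.
have [F dF] := antiderivative cphi.
rewrite /zero_mean (torus_FTC cphi dF) => -[] F01.
split; apply: contrapT => H.
  have H0 : (M 0 + F 0 = M 1 + F 1)%R.
    apply: (derive_eq0_eq ler01 (fun x => is_derive1D (dM x) (dF x))) => x _.
    by rewrite ler0_norm ?addNr// leNgt; apply/negP => px; apply: H; exists x.
  by lra.
have H0 : (M 0 - F 0 = M 1 - F 1)%R.
  apply: (derive_eq0_eq ler01 (fun x => is_derive1B (dM x) (dF x))) => x _.
  by rewrite ger0_norm ?subrr// leNgt; apply/negP => px; apply: H; exists x.
by lra.
Qed.

Lemma negative_sobolev_norm_ge0 (s : R) phi : (1 <= s)%R ->
  0 <= negative_sobolev_norm s phi.
Proof.
move=> s1; apply: (@le_trans _ _ `| \int[tor]_x (phi x * 0)%:E |) => //.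
apply: ereal_sup_ubound; exists (fun=> 0%R) => //; split.
  by split => //; exact: elementary_smooth (elementary_cst 0).
rewrite (_ : derive1 _ = fun=> 0%R); last by apply/funext => x; rewrite derive1_cst.
apply: le_trans (torus_norm_bounded _ _ (lexx _) _) _ => //.
- by rewrite hoelder_conj_ge1.
- by move=> x; exact: cvg_cst.
- by move=> x; rewrite normr0.
Qed.

(** The constant is 4 * 2 * 6: the piecewise estimate loses 4, passing from N to
the number of pieces loses 2, and the test function has norm at most 3 |phi|_{s'}
while it captures only half of the integral of |Phi| |phi|. *)
Lemma uncertainty_principle (s : R) phi : (1 <= s)%R ->
  torus_continuous phi -> (exists x, phi x <> 0%R) -> zero_mean phi ->
  sign_changes phi < +oo ->
  torus_norm 1 phi * torus_norm 1 phi <=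
  48%:E * torus_norm (hoelder_conjugate s%:E) phi *
  (sign_changes phi * negative_sobolev_norm s phi).
Proof.
move=> s1 [pphi cphi] phi0 zm fin.
have cnphi := continuous_normr cphi.
have s'1 : 1 <= hoelder_conjugate s%:E by exact: hoelder_conj_ge1.
have [M dM] := antiderivative cnphi.
have M01 := primitive_norm_gt0 pphi phi0 dM.
have [Phi1 dPhi1] := antiderivative cphi.
have Phi10 : (Phi1 1 = Phi1 0)%R.
  move: zm; rewrite /zero_mean (torus_FTC cphi dPhi1) => -[] /eqP.
  by rewrite subr_eq0 => /eqP.
have [P1 dP1] := antiderivative (is_derive1_continuous dPhi1).
pose m := (P1 1 - P1 0)%R.
pose Phi x := (Phi1 x - m)%R; pose P x := (P1 x - m * x)%R.
have dPhi x : is_derive x (1%R : R) Phi (phi x).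
  have := is_derive1B (dPhi1 x) (is_derive1_cst m x).
  by move/is_derive_eq; apply; rewrite subr0.
have dP x : is_derive x (1%R : R) P (Phi x).
  have := is_derive1B (dP1 x) (is_derive1Zl m (is_derive_id x (1%R : R))).
  by move/is_derive_eq; apply; rewrite mulr1.
have P10 : (P 1 = P 0)%R by rewrite /P /m; ring.
have pPhi : periodic Phi 1%R by apply: (periodic_primitive pphi dPhi); rewrite /Phi Phi10.
have cPhi := is_derive1_continuous dPhi.
have [Q dQ] := antiderivative (continuousM_fun (continuous_normr cPhi) cnphi).
have [[x phix] [y phiy]] := zero_mean_signs (conj pphi cphi) phi0 zm.
have [K [Kalt KN]] := alternation_bound pphi phix phiy fin.
have QB := few_alternations cphi dPhi dQ dM (normr1 R) ler01 Kalt.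
have K0 : (0 < K.+1%:R :> R)%R by rewrite ltr0n.
have Q01 : (Q 0 < Q 1)%R.
  rewrite -subr_gt0; apply: lt_le_trans QB.
  by rewrite divr_gt0 ?exprn_gt0 ?subr_gt0// mulr_gt0.
have [U [v [ev pU dU vphi UQ]]] :=
  smooth_test_function pphi cphi pPhi dPhi dM dQ dP P10 M01 Q01.
have NB := torus_norm1E cphi dM.
set B := (M 1 - M 0)%R in NB QB vphi.
have B0 : (0 < B)%R by rewrite subr_gt0.
set s' := hoelder_conjugate s%:E in s'1 *.
have Afin : torus_norm s' phi < +oo by exact: torus_norm_fin.
have BA : torus_norm 1 phi <= torus_norm s' phi.
  by apply: Lnorm1_le => //; [exact: torus_measureT|exact: continuous_measurable_fun].
have AE : torus_norm s' phi = (fine (torus_norm s' phi))%:E.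
  by rewrite fineK// ge0_fin_numE// Lnorm_ge0.
set A := fine _ in AE.
rewrite NB AE lee_fin in BA.
have A0 : (0 < A)%R by exact: lt_le_trans BA.
(* c U is the admissible test function: |v|_{s'} <= A + 2 B <= 3 A *)
pose c := ((3 * A)^-1)%R.
have c0 : (0 < c)%R by rewrite invr_gt0 mulr_gt0.
have cv := elementary_continuous ev.
have Nv : torus_norm s' v <= (3 * A)%:E.
  have cg : continuous (fun x => `|phi x| + 2 * B)%R.
    by move=> z; apply: cvgD; [exact: cnphi|exact: cvg_cst].
  apply: (@le_trans _ _ (torus_norm s' (fun x => `|phi x| + 2 * B)%R)).
    apply: torus_norm_le => // z.
    by rewrite [leRHS]ger0_norm// addr_ge0// mulr_ge0// ltW.
  apply: (@le_trans _ _ (torus_norm s' (fun x => `|phi x|)%R + torus_norm s' (cst (2 * B)%R))).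
    apply: eminkowski => //; first exact: continuous_measurable_fun.
  rewrite (_ : 3 * A = A + 2 * A)%R; last by ring.
  rewrite EFinD; apply: leeD.
    by rewrite -AE; apply: torus_norm_le => // z; rewrite normr_id.
  apply: le_trans (torus_norm_bounded s'1 _ _ _) _; last by rewrite lee_fin; exact: ler_wpM2l BA.
  - by move=> z; exact: cvg_cst.
  - by rewrite mulr_ge0// ltW.
  - by move=> z; rewrite /= ger0_norm// mulr_ge0// ltW.
have dcU z := is_derive1Zl c (dU z).
have ecv : elementary (fun x => c * v x)%R by apply: elementaryM => //; exact: elementary_cst.
have D : ((c * ((Q 1 - Q 0) / 2))%:E <= negative_sobolev_norm s phi)%E.
  apply: (@le_trans _ _ `| \int[tor]_x (phi x * (c * U x))%:E |); last first.
    apply: ereal_sup_ubound; exists (fun x => c * U x)%R => //; split.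
      split; first by move=> z; rewrite pU.
      exact: smooth_primitive ecv dcU.
    rewrite (_ : derive1 _ = (fun x => c * v x)%R); last first.
      by apply/funext => z; rewrite derive1E; exact: derive_val.
    rewrite torus_normZ// ?(ltW c0)//.
    apply: (@le_trans _ _ (c%:E * (3 * A)%:E)); first by rewrite lee_pmul2l.
    by rewrite -EFinM lee_fin mulVf// gt_eqF// mulr_gt0.
  have cU := is_derive1_continuous dU.
  have cphiU : continuous (fun x => phi x * U x)%R by exact: continuousM_fun.
  have iphiU := torus_integrable cphiU.
  under eq_integral do rewrite mulrCA EFinM.
  rewrite integralZl// abseM gee0_abs ?lee_fin ?(ltW c0)// EFinM.
  apply: lee_wpmul2l; first by rewrite lee_fin ltW.
  by rewrite -EFin_normr_Rintegral// lee_fin.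
have NE : sign_changes phi = (fine (sign_changes phi))%:E.
  rewrite fineK// ge0_fin_numE//.
  by apply: le_trans (sign_changes_ge2 pphi phix phiy); rewrite lee_fin.
set N := fine _ in NE; rewrite NE -EFinM lee_fin in KN.
rewrite NB NE AE -EFinM.
apply: (@le_trans _ _ ((48%:E * A%:E) * (N%:E * (c * ((Q 1 - Q 0) / 2))%:E))); last first.
  apply: lee_wpmul2l; first by rewrite lee_fin mulr_ge0// ltW.
  apply: lee_wpmul2l => //; rewrite lee_fin; lra.
rewrite -!EFinM lee_fin.
have -> : (48 * A * (N * (c * ((Q 1 - Q 0) / 2))) = 8 * N * (Q 1 - Q 0))%R.
  by rewrite /c; field; rewrite gt_eqF.
move: QB; rewrite ler_pdivrMr ?mulr_gt0// => QB.
have : (0 < Q 1 - Q 0)%R by rewrite subr_gt0.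
rewrite expr2 in QB; nra.
Qed.

(** The hypothesis on the exponents is that of [Lnorm_product_le] for p, q, s'
and r, as 1/s' = 1 - 1/s; the product inequality turns the endpoint inequality
into the general one. *)
Lemma sufficiency (s alpha : R) p q r :
  (1 <= s)%R -> (1 <= alpha)%R -> 1 <= p -> 1 <= q -> 1 <= r ->
  p^-1 + q^-1 - r^-1 >= 1 + s%:E^-1 ->
  forall phi, torus_continuous phi -> (exists x, phi x <> 0%R) -> zero_mean phi ->
  sign_changes phi < +oo ->
  (48^-1)%:E%R * (torus_norm p phi * torus_norm q phi / torus_norm r phi) <=
  sign_changes phi `^ alpha * negative_sobolev_norm s phi.
Proof.
move=> s1 alpha1 p1 q1 r1 pqr phi [pphi cphi] phi0 zm fin.
set s' := hoelder_conjugate s%:E.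
have s'1 : 1 <= s' by exact: hoelder_conj_ge1.
have mphi : measurable_fun [set: R] phi by exact: continuous_measurable_fun.
have UP := uncertainty_principle s1 (conj pphi cphi) phi0 zm fin.
rewrite -/s' in UP.
have [M dM] := antiderivative (continuous_normr cphi).
have M01 := primitive_norm_gt0 pphi phi0 dM.
have N10 : 0 < torus_norm 1 phi by rewrite (torus_norm1E cphi dM) lte_fin subr_gt0.
have Nfin t : 1 <= t -> torus_norm t phi = (fine (torus_norm t phi))%:E.
  by move=> t1; rewrite fineK// ge0_fin_numE ?Lnorm_ge0// torus_norm_fin.
have Npos t : 1 <= t -> (0 < fine (torus_norm t phi))%R.
  move=> t1; rewrite -lte_fin -Nfin//; apply: lt_le_trans N10 _.
  by apply: Lnorm1_le => //; exact: torus_measureT.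
have prod : torus_norm p phi * torus_norm q phi * torus_norm s' phi <=
    torus_norm 1 phi * torus_norm 1 phi * torus_norm r phi.
  apply: Lnorm_product_le => //; [exact: torus_measureT|exact: torus_norm_fin|].
  have [pE _] := inv_exponent p1; have [qE _] := inv_exponent q1.
  have [s'E _] := inv_exponent s'1; have [rE _] := inv_exponent r1.
  have [sE _] := @inv_exponent _ s%:E s1.
  have : s%:E^-1 + s'^-1 = 1.
    by apply: hoelder_conjugate_eq1; rewrite ?ltNyr// gt_eqF// lte_fin (lt_le_trans _ s1).
  rewrite -sE -s'E -EFinD => -[H].
  move: pqr; rewrite -pE -qE -rE -sE -s'E -!EFinN -!EFinD !lee_fin.
  lra.
have N2 : 2%:E <= sign_changes phi.
  have [[x phix] [y phiy]] := zero_mean_signs (conj pphi cphi) phi0 zm.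
  exact: sign_changes_ge2 pphi phix phiy.
have NE : sign_changes phi = (fine (sign_changes phi))%:E.
  by rewrite fineK// ge0_fin_numE// (le_trans _ N2).
set N := fine _ in NE; rewrite NE in UP N2 *; rewrite lee_fin in N2.
have D0 := negative_sobolev_norm_ge0 phi s1.
set D := negative_sobolev_norm s phi in UP D0 *.
apply: (@le_trans _ _ (N%:E * D)); last first.
  by rewrite poweR_EFin lee_wpmul2r// lee_fin le1r_powR// (le_trans _ N2)// ler1n.
have ND0 : 0 <= N%:E * D by rewrite mule_ge0// lee_fin (le_trans _ N2).
case: (N%:E * D) ND0 UP => [x x0 UP|_ _|//]; last by rewrite leey.
move: UP prod; rewrite (Nfin _ p1) (Nfin _ q1) (Nfin _ r1) (Nfin _ s'1) (Nfin 1)//.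
have := Npos _ r1; have := Npos _ s'1.
move: (fine _) (fine _) (fine _) (fine _) (fine _) => B Nq Np Nr A A0 Nr0.
rewrite inver (gt_eqF Nr0) -!EFinM !lee_fin => h1 h2.
rewrite mulrA ler_pdivrMr// mulrC ler_pdivrMr// -(ler_pM2r A0).
apply: le_trans h2 _.
by apply: le_trans (ler_wpM2r (ltW Nr0) h1) _; rewrite le_eqVlt; apply/orP; left; apply/eqP; ring.
Qed.

End sufficiency.

(** * Periodic bumps *)

Section periodization.
Context {R : realType}.
Implicit Types (f : R -> R).

Definition periodize f x := f (x - (Num.floor x)%:~R).

Lemma periodize_periodic f : periodic (periodize f) 1.
Proof.
move=> x; rewrite /periodize.
have -> : Num.floor (x + 1) = Num.floor x + 1.
  apply: floor_def; have /andP[h1 h2] := floor_itv x.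
  by rewrite !intrD lerD2r h1/= ltrD2r -intrD.
by rewrite intrD; congr f; ring.
Qed.

Lemma periodizeE f : (forall y, ~ (0 < y < 1) -> f y = 0) ->
  forall y, 0 <= y <= 1 -> periodize f y = f y.
Proof.
move=> f0 y /andP[y0]; rewrite le_eqVlt => /predU1P[->|y1].
  rewrite /periodize floor1 subrr !f0// ?ltxx//; lra.
rewrite /periodize (_ : Num.floor y = 0) ?subr0//.
by apply: floor_def; rewrite y0/= add0r.
Qed.

(** Around x, with k the integer part of x, the periodization is the sum of the
two translates of f supported in [k, k + 1] and [k - 1, k]. *)
Lemma periodize_continuous f : (forall y, ~ (0 < y < 1) -> f y = 0) ->
  continuous f -> continuous (periodize f).
Proof.
move=> f0 cf x.
pose k : R := (Num.floor x)%:~R.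
have /andP[k1 k2] := floor_itv x; rewrite intrD -/k in k1 k2.
pose F y := f (y - k) + f (y - k + 1).
have cF : continuous F.
  move=> y; apply: cvgD.
    apply: (@continuous_comp _ _ _ (fun y => y - k) f); last exact: cf.
    by apply: cvgB; [exact: cvg_id|exact: cvg_cst].
  apply: (@continuous_comp _ _ _ (fun y => y - k + 1) f); last exact: cf.
  by apply: cvgD; [apply: cvgB; [exact: cvg_id|exact: cvg_cst]|exact: cvg_cst].
have FE y : k - 1 < y < k + 1 -> F y = periodize f y.
  move=> /andP[y1 y2]; rewrite /F /periodize.
  have [ky|yk] := leP k y.
    rewrite (_ : Num.floor y = Num.floor x); last first.
      by apply: floor_def; rewrite intrD -/k ky.
    by rewrite -/k [X in _ + X]f0 ?addr0//; move=> /andP[_]; lra.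
  rewrite (_ : Num.floor y = Num.floor x - 1); last first.
    by apply: floor_def; rewrite subrK intrB -/k (ltW y1).
  rewrite intrB -/k f0 ?add0r; last by move=> /andP[]; lra.
  by congr f; ring.
rewrite /continuous_at -(FE x); last by lra.
apply: cvg_trans (cF x); apply: near_eq_cvg; near=> y.
apply: FE; apply/andP; split; near: y; [apply: lt_nbhsr|apply: lt_nbhsl]; lra.
Unshelve. all: by end_near. Qed.

(** The integer part of 2 x is even where the periodization is positive and odd
where it is negative.  Along points of alternating signs it therefore increases
by at least 1 at each step, while over less than one period it increases by at
most 2. *)
Lemma periodize_sign_changes f (m : nat) : (forall y, ~ (0 < y < 1) -> f y = 0) ->
  (forall y, 2^-1 <= y -> f y <= 0) -> (forall y, y <= 2^-1 -> 0 <= f y) ->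
  has_sign_changes (periodize f) m -> (m <= 3)%N.
Proof.
move=> f0 fneg fpos; case: m => // m [x [xlt x1 xsg]].
pose h (i : 'I_m.+1) := Num.floor (2 * x i).
have hpos i : 0 < periodize f (x i) -> h i = 2 * Num.floor (x i).
  move=> px; apply: floor_def.
  have /andP[k1 k2] := floor_itv (x i); rewrite intrD in k2.
  have : x i - (Num.floor (x i))%:~R < 2^-1.
    by rewrite ltNge; apply/negP => /fneg; rewrite leNgt => /negP.
  by rewrite intrD intrM; lra.
have hneg i : periodize f (x i) < 0 -> h i = 2 * Num.floor (x i) + 1.
  move=> px; apply: floor_def.
  have /andP[k1 k2] := floor_itv (x i); rewrite intrD in k2.
  have : 2^-1 < x i - (Num.floor (x i))%:~R.
    by rewrite ltNge; apply/negP => /fpos; rewrite leNgt => /negP.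
  by rewrite !intrD intrM; lra.
have hS (i j : 'I_m.+1) : j = i.+1 :> nat -> h i + 1 <= h j.
  move=> ji.
  have jE : j = ordS i by apply: val_inj; rewrite /= ji modn_small// -ji ltn_ord.
  have le : h i <= h j.
    by apply: le_floor; rewrite ler_pM2l// ltW// xlt// ji.
  have := xsg i; rewrite -jE => sgn.
  have [p|p] := ltP 0 (periodize f (x i)).
    have q : periodize f (x j) < 0 by move: sgn; rewrite pmulr_rlt0.
    move: le; rewrite (hpos _ p) (hneg _ q); lia.
  have p' : periodize f (x i) < 0.
    rewrite lt_neqAle p andbT; apply/eqP => E; move: sgn; rewrite E mul0r ltxx//.
  have q : 0 < periodize f (x j) by move: sgn; rewrite nmulr_rlt0.
  move: le; rewrite (hneg _ p') (hpos _ q); lia.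
have hi (n : nat) (i : 'I_m.+1) : i = n :> nat -> h ord0 + n%:Z <= h i.
  elim: n i => [|n IH] i iE.
    by rewrite addr0 (_ : i = ord0)//; apply: val_inj.
  have nm : (n < m.+1)%N by rewrite (ltn_trans _ (ltn_ord i))// iE.
  have := hS (Ordinal nm) i iE; have := IH (Ordinal nm) erefl; lia.
have := hi m ord_max erefl.
have : h ord_max <= h ord0 + 2.
  have -> : h ord0 + 2 = Num.floor (2 * x ord0 + 2).
    apply/esym/floor_def; rewrite /h; have /andP[k1 k2] := floor_itv (2 * x ord0).
    by move: k1 k2; rewrite !intrD; lra.
  by apply: le_floor; have := x1 ord0 ord_max; lra.
lia.
Qed.

End periodization.

Section bump.
Context {R : realType}.
Implicit Types (w y : R).

(** A C^1 bump centred at 1/2, of half-width w and height w ^ 4; the square of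
[pospart] of a quadratic polynomial keeps all estimates polynomial in w. *)
Definition bump w y : R := pospart (w ^+ 2 - (y - 2^-1) ^+ 2) ^+ 2.
Definition bump' w y : R := -4 * (y - 2^-1) * pospart (w ^+ 2 - (y - 2^-1) ^+ 2).

Lemma is_derive1_bump w y : is_derive y (1 : R) (bump w) (bump' w y).
Proof.
have d1 := is_derive1B (is_derive_id y (1 : R)) (is_derive1_cst 2^-1 y).
have d2 := is_derive1B (is_derive1_cst (w ^+ 2) y) (is_derive1M d1 d1).
have := @is_derive1_comp _ (fun y => pospart y ^+ 2) (fun y => w ^+ 2 - (y - 2^-1) * (y - 2^-1)) y _ _
  (is_derive1_sqr_pospart _) d2.
by move/is_derive_eq; apply; rewrite /bump' expr2; ring.
Qed.

Lemma continuous_pospart : continuous (@pospart R).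
Proof.
have -> : @pospart R = fun y => 2^-1 * (y + `|y|).
  apply/funext => y; have [y0|/ltW y0] := leP 0 y.
    by rewrite pospart_pos// ger0_norm//; lra.
  by rewrite pospart_neg// ler0_norm//; lra.
move=> y; apply: cvgM; first exact: cvg_cst.
by apply: cvgD; [exact: cvg_id|exact: norm_continuous].
Qed.

Lemma continuous_bump' w : continuous (bump' w).
Proof.
have c1 : continuous (fun y : R => y - 2^-1).
  by move=> y; apply: cvgB; [exact: cvg_id|exact: cvg_cst].
apply: continuousM_fun.
  by apply: (@continuousM_fun _ (fun=> -4)) => // y; exact: cvg_cst.
move=> y; apply: (@continuous_comp _ _ _ (fun y : R => w ^+ 2 - (y - 2^-1) ^+ 2)); last exact: continuous_pospart.
apply: cvgB; first exact: cvg_cst.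
exact: (continuousM_fun c1 c1).
Qed.

Lemma bump_support w y : 0 < w -> ~ (2^-1 - w <= y <= 2^-1 + w) ->
  pospart (w ^+ 2 - (y - 2^-1) ^+ 2) = 0.
Proof.
move=> w0 H; apply: pospart_neg.
have [h|h] := leP (2^-1 - w) y; last by nra.
have [h'|h'] := leP y (2^-1 + w); last by nra.
by exfalso; apply: H; rewrite h h'.
Qed.

Lemma bump_bound w y : 0 < w -> 0 <= pospart (w ^+ 2 - (y - 2^-1) ^+ 2) <= w ^+ 2.
Proof.
move=> w0; rewrite pospart_ge0/= /pospart ge_max sqr_ge0/=.
by rewrite lerBlDr lerDl sqr_ge0.
Qed.

Lemma bump'_le w y : 0 < w -> `|bump' w y| <= 4 * w ^+ 3.
Proof.
move=> w0.
have [yw|yw] := pselect (2^-1 - w <= y <= 2^-1 + w); last first.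
  by rewrite /bump' bump_support// mulr0 normr0 mulr_ge0// exprn_ge0// ltW.
have /andP[h1 h2] := bump_bound y w0.
rewrite /bump' !normrM (ger0_norm h1) normrN [`|4|]ger0_norm// -mulrA ler_pM2l//.
rewrite exprS; apply: ler_pM => //.
by rewrite ler_norml; apply/andP; case/andP: yw; split; lra.
Qed.

Lemma bump_le w y : 0 < w -> `|bump w y| <= w ^+ 4.
Proof.
move=> w0; have /andP[h1 h2] := bump_bound y w0.
rewrite /bump normrX (ger0_norm h1) (_ : 4 = 2 * 2)%N// exprM.
by apply: lerXn2r; rewrite ?nnegrE// sqr_ge0.
Qed.

Lemma bump'_ge w y : 0 < w -> 2^-1 + w / 4 <= y <= 2^-1 + w / 2 ->
  w ^+ 3 / 2 <= `|bump' w y|.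
Proof.
move=> w0 /andP[y1 y2].
have h : 3 / 4 * w ^+ 2 <= w ^+ 2 - (y - 2^-1) ^+ 2.
  have : (y - 2^-1) ^+ 2 <= (w / 2) ^+ 2 by apply: lerXn2r; rewrite ?nnegrE; lra.
  rewrite expr_div_n; lra.
have w20 : 0 <= w ^+ 2 by rewrite sqr_ge0.
have h0 : 0 <= w ^+ 2 - (y - 2^-1) ^+ 2 by lra.
rewrite /bump' pospart_pos// !normrM normrN (ger0_norm h0) [`|4|]ger0_norm//.
rewrite ger0_norm; last by lra.
have : w * (3 / 4 * w ^+ 2) <= 4 * (y - 2^-1) * (w ^+ 2 - (y - 2^-1) ^+ 2).
  apply: ler_pM => //; [exact: ltW|by rewrite mulr_ge0//; lra|lra].
have : 0 < w ^+ 3 by rewrite exprn_gt0.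
rewrite !exprS expr0; nra.
Qed.

End bump.

(** * Necessity of the condition on the exponents *)

Section necessity.
Context {R : realType}.
Local Open Scope ereal_scope.
Local Notation tor := (torus_measure R).
Local Notation itvR a b := (`[a%R, b%R]%classic : set (measurableTypeR R)).
Implicit Types (f g phi : R -> R) (p q r : \bar R) (w : R).

Lemma torus_integral_eq f g : continuous f -> continuous g ->
  (forall x, 0 <= x <= 1 -> f x = g x)%R ->
  \int[tor]_x (f x)%:E = \int[tor]_x (g x)%:E.
Proof.
move=> cf cg fg; apply: ae_eq_integral => //.
- by apply/measurable_EFinP; exact: continuous_measurable_fun.
- by apply/measurable_EFinP; exact: continuous_measurable_fun.
- by apply: torus_ae => x x01 _; rewrite fg.
Qed.

Lemma torus_norm_eq p f g : continuous f -> continuous g ->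
  (forall x, 0 <= x <= 1 -> f x = g x)%R -> torus_norm p f = torus_norm p g.
Proof.
move=> cf cg fg; rewrite /torus_norm.
have mf : measurable_fun [set: R] f by exact: continuous_measurable_fun.
have mg : measurable_fun [set: R] g by exact: continuous_measurable_fun.
case: p => [p||].
- rewrite !LnormE; congr (_ `^ _); apply: ae_eq_integral => //.
  + by apply/measurable_EFinP; exact: measurable_normr_powR.
  + by apply/measurable_EFinP; exact: measurable_normr_powR.
  + by apply: torus_ae => x x01 _; rewrite fg.
- rewrite unlock; case: ifPn => // _; apply: eq_ess_sup.
  by apply: torus_ae => x x01 /=; rewrite fg.
- rewrite unlock; case: ifPn => // _; apply: eq_ess_inf.
  by apply: torus_ae => x x01 /=; rewrite fg.
Qed.

Lemma torus_measure_itv (a b : R) : (0 <= a)%R -> (a < b)%R -> (b <= 1)%R ->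
  tor (itvR a b) = (b - a)%:E.
Proof.
move=> a0 ab b1; rewrite torus_measureE setIidl; last first.
  by apply: subset_itv; rewrite bnd_simp.
by rewrite lebesgue_measure_itv/= lte_fin ab.
Qed.

Definition periodic_bump' w : R -> R := periodize (bump' w).

Section small_width.
Variable w : R.
Hypothesis w0 : (0 < w)%R.
Hypothesis w4 : (w <= 4^-1)%R.

Lemma bump'_outside (y : R) : ~ (0 < y < 1)%R -> bump' w y = 0%R.
Proof.
move: (w0) (w4) => ? ?.
move=> H; rewrite /bump' bump_support ?mulr0// => /andP[h1 h2]; apply: H.
by apply/andP; split; lra.
Qed.

Lemma bump_outside (y : R) : ~ (0 < y < 1)%R -> bump w y = 0%R.
Proof.
move: (w0) (w4) => ? ?.
move=> H; rewrite /bump bump_support ?expr0n// => /andP[h1 h2]; apply: H.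
by apply/andP; split; lra.
Qed.

Lemma periodic_bump'_continuous : continuous (periodic_bump' w).
Proof. by apply: periodize_continuous; [exact: bump'_outside|exact: continuous_bump']. Qed.

Lemma periodic_bump'E (y : R) : (0 <= y <= 1)%R -> periodic_bump' w y = bump' w y.
Proof. by apply: periodizeE; exact: bump'_outside. Qed.

Lemma bump01 : bump w 0 = 0%R /\ bump w 1 = 0%R.
Proof. by rewrite !bump_outside// ?ltxx ?andbF. Qed.

Lemma periodic_bump'_zero_mean : zero_mean (periodic_bump' w).
Proof.
rewrite /zero_mean (torus_integral_eq periodic_bump'_continuous (@continuous_bump' _ w) periodic_bump'E).
rewrite (torus_FTC (@continuous_bump' _ w) (is_derive1_bump w)).
by have [-> ->] := bump01; rewrite subrr.
Qed.

Lemma periodic_bump'_sign_changes : sign_changes (periodic_bump' w) <= 3%:R%:E.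
Proof.
apply: ge_ereal_sup => _ [m /= Hm <-]; rewrite lee_fin ler_nat.
apply: periodize_sign_changes Hm; first exact: bump'_outside.
- move=> y y2; rewrite /bump' mulNr mulNr oppr_le0 mulr_ge0 ?pospart_ge0//.
  by rewrite mulr_ge0// subr_ge0.
- move=> y y2; rewrite /bump' mulr_ge0 ?pospart_ge0//.
  by rewrite mulNr oppr_ge0 pmulr_rle0// subr_le0.
Qed.

(** The lower bound comes from the segment at distance between w/4 and w/2 from
the centre, where the derivative of the bump is of full size. *)
Lemma periodic_bump'_norm_ge p : 1 <= p ->
  (w ^+ 3 / 2 * (w / 4) `^ (fine p^-1))%:E <= torus_norm p (periodic_bump' w).
Proof.
move: (w0) (w4) => ? ?.
move=> p1.
have DE : tor (itvR (2^-1 + w / 4) (2^-1 + w / 2)) = (w / 4)%:E.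
  rewrite torus_measure_itv; [congr EFin|..]; lra.
have := @Lnorm_ge_support _ _ _ tor (periodic_bump' w) (itvR (2^-1 + w / 4) (2^-1 + w / 2)) (w ^+ 3 / 2) p p1.
rewrite DE /=; apply.
- by apply: continuous_measurable_fun; exact: periodic_bump'_continuous.
- exact: measurable_itv.
- by rewrite ltry.
- by rewrite lte_fin divr_gt0.
- by rewrite divr_ge0// exprn_ge0// ltW.
- move=> x; rewrite in_itv/= => xw; rewrite periodic_bump'E ?bump'_ge//.
  by case/andP: xw => h1 h2; apply/andP; split; lra.
Qed.

Lemma bump_itv_measure : tor (itvR (2^-1 - w) (2^-1 + w)) = (2 * w)%:E.
Proof.
move: (w0) (w4) => ? ?.
by rewrite torus_measure_itv; [congr EFin|..]; lra.
Qed.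

Lemma periodic_bump'_norm_le p : 1 <= p ->
  torus_norm p (periodic_bump' w) <= (4 * w ^+ 3 * (2 * w) `^ (fine p^-1))%:E.
Proof.
move=> p1.
rewrite (torus_norm_eq p periodic_bump'_continuous (@continuous_bump' _ w) periodic_bump'E).
have := @Lnorm_le_support _ _ _ tor (bump' w) (itvR (2^-1 - w) (2^-1 + w)) (4 * w ^+ 3) p p1.
rewrite bump_itv_measure /=; apply.
- by apply: continuous_measurable_fun; exact: continuous_bump'.
- exact: measurable_itv.
- by rewrite ltry.
- by rewrite mulr_ge0// exprn_ge0// ltW.
- by move=> x; exact: bump'_le.
- by move=> x H; rewrite /bump' bump_support ?mulr0// => xw; apply: H; rewrite /= in_itv.
Qed.

Lemma bump_norm_le p : 1 <= p ->
  torus_norm p (bump w) <= (w ^+ 4 * (2 * w) `^ (fine p^-1))%:E.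
Proof.
move=> p1.
have := @Lnorm_le_support _ _ _ tor (bump w) (itvR (2^-1 - w) (2^-1 + w)) (w ^+ 4) p p1.
rewrite bump_itv_measure /=; apply.
- by apply: continuous_measurable_fun; exact: is_derive1_continuous (is_derive1_bump w).
- exact: measurable_itv.
- by rewrite ltry.
- by rewrite exprn_ge0// ltW.
- by move=> x; exact: bump_le.
- by move=> x H; rewrite /bump bump_support ?expr0n// => xw; apply: H; rewrite /= in_itv.
Qed.

(** Integrating by parts moves the derivative from the bump to the test function,
and Hoelder's inequality bounds the result by the L^s norm of the bump. *)
Lemma periodic_bump'_sobolev_le (s : R) : (1 <= s)%R ->
  negative_sobolev_norm s (periodic_bump' w) <= (w ^+ 4 * (2 * w) `^ s^-1)%:E.
Proof.
move=> s1; apply: ge_ereal_sup => _ [u [[pu su] nu] <-].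
have du x : is_derive x (1%R : R) u (derive1 u x).
  by rewrite derive1E; apply: derivableP; exact: (su 0%N x).
have cu := is_derive1_continuous du.
have cu' : continuous (derive1 u) by apply: derivable_continuous => x; exact: (su 1%N x).
have cb' := @continuous_bump' _ w.
have db := is_derive1_bump w.
have cb := is_derive1_continuous db.
have cbu := continuousM_fun cb' cu; have cbu' := continuousM_fun cb cu'.
rewrite (@torus_integral_eq _ (fun x => bump' w x * u x)%R) //; last 2 first.
- by apply: continuousM_fun => //; exact: periodic_bump'_continuous.
- by move=> x x01; rewrite periodic_bump'E.
have [W dW] := antiderivative cbu.
have dV x := is_derive1B (is_derive1M (db x) (du x)) (dW x).
have dV' x : is_derive x (1%R : R) (fun y => bump w y * u y - W y)%R (bump w x * derive1 u x)%R.
  by apply: is_derive_eq (dV x) _; ring.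
have -> : \int[tor]_x (bump' w x * u x)%:E = - \int[tor]_x (bump w x * derive1 u x)%:E.
  rewrite (torus_FTC cbu dW) (torus_FTC cbu' dV').
  by have [-> ->] := bump01; rewrite -EFinN; congr EFin; ring.
rewrite abseN.
apply: le_trans (le_abse_integral _ _ _) _ => //.
  by apply/measurable_EFinP; exact: continuous_measurable_fun.
have := @hoelder_conjugate_le1 _ _ _ tor (bump w) (derive1 u) s _ s1 _ _ nu.
rewrite torus_measureT Lnorm1 => H.
apply: le_trans (H _ _ _) _.
- exact: lte01.
- exact: continuous_measurable_fun.
- exact: continuous_measurable_fun.
by rewrite -(inv_exponent_fin s1); exact: bump_norm_le.
Qed.

End small_width.

(** If y > x, then z ^ (y - x) tends to 0 with z and cannot stay above C / K. *)
Lemma exponent_comparison (C K x y : R) : (0 < C)%R ->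
  (forall z, 0 < z -> z <= 16^-1 -> C * z `^ x <= K * z `^ y)%R -> (y <= x)%R.
Proof.
move=> C0 H; rewrite leNgt; apply/negP => xy.
have e0 : (0 < y - x)%R by rewrite subr_gt0.
have zK z : (0 < z -> z <= 16^-1 -> C <= K * z `^ (y - x))%R.
  move=> z0 z16; have := H z z0 z16.
  have -> : (y = (y - x) + x)%R by rewrite subrK.
  rewrite powRD; last by rewrite (gt_eqF z0) implybT.
  by rewrite addrK mulrA ler_pM2r// powR_gt0.
have K0 : (0 < K)%R.
  have := zK 16^-1%R (ltac:(by rewrite invr_gt0)) (lexx _).
  by move/(lt_le_trans C0); rewrite pmulr_lgt0// powR_gt0// invr_gt0.
pose t : R := (C / (2 * K))%R.
have t0 : (0 < t)%R by rewrite divr_gt0// mulr_gt0.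
(* chosen so that K z ^ (y - x) <= C / 2 *)
pose z : R := Num.min 16^-1%R (t `^ (y - x)^-1)%R.
have z0 : (0 < z)%R by rewrite lt_min invr_gt0 powR_gt0//= ltr0n.
have z16 : (z <= 16^-1)%R by rewrite ge_min lexx.
have zt : (z `^ (y - x) <= t)%R.
  rewrite -[leRHS](powRr1 (ltW t0)) -(mulVf (lt0r_neq0 e0)) powRrM.
  by apply: ge0_ler_powR; rewrite ?nnegrE ?powR_ge0 ?(ltW e0) ?(ltW z0)// ge_min lexx orbT.
have := zK z z0 z16.
have : (K * z `^ (y - x) <= K * t)%R by rewrite ler_pM2l.
have -> : (K * t = C / 2)%R by rewrite /t; field; rewrite gt_eqF.
lra.
Qed.

(** The inequality for the bump of half-width w = 4 z reads
C z ^ (1/p + 1/q) <= const * z ^ (1 + 1/s + 1/r). *)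
Lemma necessity (s alpha C : R) p q r :
  (1 <= s)%R -> (1 <= alpha)%R -> 1 <= p -> 1 <= q -> 1 <= r -> (0 < C)%R ->
  (forall phi, torus_continuous phi -> (exists x, phi x <> 0%R) -> zero_mean phi ->
    sign_changes phi < +oo ->
    C%:E * (torus_norm p phi * torus_norm q phi / torus_norm r phi) <=
    sign_changes phi `^ alpha * negative_sobolev_norm s phi) ->
  1 + s%:E^-1 <= p^-1 + q^-1 - r^-1.
Proof.
move=> s1 alpha1 p1 q1 r1 C0 H.
have [pE _] := inv_exponent p1; have [qE _] := inv_exponent q1.
have [rE _] := inv_exponent r1.
have s0 : (0 < s)%R by exact: lt_le_trans s1.
rewrite -pE -qE -rE inver (gt_eqF s0) -EFinN -!EFinD lee_fin.
set a := fine p^-1; set b := fine q^-1; set c := fine r^-1.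
suff : (1 + s^-1 + c <= a + b)%R by lra.
(* with w = 4 z the lower bounds involve z and the upper bounds 8 z *)
apply: (@exponent_comparison C (64 * 3 `^ alpha * 8 `^ (s^-1 + c))%R _ _ C0) => z z0 z16.
pose w : R := (4 * z)%R.
have w0 : (0 < w)%R by rewrite mulr_gt0.
have w4 : (w <= 4^-1)%R by rewrite /w; lra.
have wz : (w / 4 = z)%R by rewrite /w mulrC mulKf.
have wz8 : (2 * w = 8 * z)%R by rewrite /w; ring.
have P := periodic_bump'_norm_ge w0 w4 p1; have Q := periodic_bump'_norm_ge w0 w4 q1.
have R0 := periodic_bump'_norm_ge w0 w4 r1; have R1 := periodic_bump'_norm_le w0 w4 r1.
have D := periodic_bump'_sobolev_le w0 w4 s1.
have N3 := periodic_bump'_sign_changes w0 w4.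
rewrite wz -/a in P; rewrite wz -/b in Q; rewrite wz -/c in R0; rewrite wz8 -/c in R1.
rewrite wz8 in D.
set phi := periodic_bump' w in P Q R0 R1 D N3.
have cphi : continuous phi := periodic_bump'_continuous w0 w4.
have pphi : periodic phi 1%R := periodize_periodic _.
have {H} := H phi (conj pphi cphi) _ (periodic_bump'_zero_mean w0 w4) (le_lt_trans N3 (ltry _)).
have w3 : (0 < w ^+ 3)%R by rewrite exprn_gt0.
have phi0 : exists x, phi x <> 0%R.
  exists (2^-1 + w / 4)%R; rewrite /phi periodic_bump'E//; last by apply/andP; split; lra.
  have : (w ^+ 3 / 2 <= `|bump' w (2^-1 + w / 4)|)%R by apply: bump'_ge => //; apply/andP; split; lra.
  by move=> h E; move: h; rewrite E normr0; lra.
move=> /(_ phi0).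
have N0 : 0 <= sign_changes phi.
  by apply: ereal_sup_ubound; exists 0%N => //; exists (fun=> 0%R); split => -[].
have Np t : 1 <= t -> torus_norm t phi = (fine (torus_norm t phi))%:E.
  by move=> t1; rewrite fineK// ge0_fin_numE ?Lnorm_ge0// torus_norm_fin.
have DE : sign_changes phi `^ alpha * negative_sobolev_norm s phi <=
    (3 `^ alpha * (w ^+ 4 * (8 * z) `^ s^-1))%:E.
  rewrite EFinM -poweR_EFin; apply: lee_pmul => //.
  - exact: poweR_ge0.
  - exact: negative_sobolev_norm_ge0.
  - by apply: poweR_mono => //; exact: le_trans alpha1.
move=> H; have {H DE} := le_trans H DE.
rewrite (Np p p1) in P *; rewrite (Np q q1) in Q *; rewrite (Np r r1) in R0 R1 *.
move: P Q R0 R1; rewrite !lee_fin.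
move: (fine _) (fine _) (fine _) => Nr Nq Np' P Q R0 R1.
have za t : (0 < z `^ t)%R by rewrite powR_gt0.
have Nr0 : (0 < Nr)%R by apply: lt_le_trans R0; rewrite mulr_gt0// divr_gt0.
rewrite inver (gt_eqF Nr0) -!EFinM lee_fin mulrA ler_pdivrMr// => H.
have zn0 (t : R) : ((t == 0) ==> (z != 0))%R by apply/implyP => _; rewrite gt_eqF.
have -> : (z `^ (a + b) = z `^ a * z `^ b)%R by rewrite powRD.
have -> : (64 * 3 `^ alpha * 8 `^ (s^-1 + c) * z `^ (1 + s^-1 + c) =
    64 * 3 `^ alpha * (z * (8 * z) `^ s^-1 * (8 * z) `^ c))%R.
  rewrite -!mulrA -powRD; last by apply/implyP => _; rewrite gt_eqF// mulr_gt0.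
  rewrite powRM ?(ltW z0)//.
  rewrite (_ : z `^ (1 + s^-1 + c) = z * z `^ (s^-1 + c))%R; last first.
    by rewrite -addrA (powRD (zn0 _)) powRr1 ?(ltW z0).
  by congr (_ * (_ * _))%R; rewrite mulrCA.
have H1 : (C * ((w ^+ 3 / 2 * z `^ a) * (w ^+ 3 / 2 * z `^ b)) <=
    3 `^ alpha * (w ^+ 4 * (8 * z) `^ s^-1) * (4 * w ^+ 3 * (8 * z) `^ c))%R.
  apply: le_trans (ler_wpM2l (ltW C0) _) _.
    by apply: ler_pM P Q; rewrite mulr_ge0 ?powR_ge0// divr_ge0// ltW.
  apply: le_trans H _; apply: ler_wpM2l R1.
  have w40 : (0 <= w ^+ 4)%R by rewrite exprn_ge0// ltW.
  by apply: mulr_ge0; rewrite ?powR_ge0//; apply: mulr_ge0; rewrite ?powR_ge0.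
have w6 : (0 < w ^+ 3 * w ^+ 3 / 4)%R by rewrite divr_gt0// mulr_gt0.
rewrite -(ler_pM2l w6).
move: H1; set X := (_ `^ s^-1)%R; set Y := ((8 * z) `^ c)%R.
set A := (3 `^ alpha)%R; set Za := (z `^ a)%R; set Zb := (z `^ b)%R.
have -> : (C * (w ^+ 3 / 2 * Za * (w ^+ 3 / 2 * Zb)) =
  w ^+ 3 * w ^+ 3 / 4 * (C * (Za * Zb)))%R by field.
have -> : (A * (w ^+ 4 * X) * (4 * w ^+ 3 * Y) =
  w ^+ 3 * w ^+ 3 / 4 * (64 * A * (z * X * Y)))%R by rewrite -wz; field.
by [].
Qed.

End necessity.

Local Open Scope ereal_scope.

Theorem theorem1p1 (R : realType) (s alpha : R) (p q r : \bar R)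
    (hs : (1 <= s)%R) (halpha : (1 <= alpha)%R)
    (hp : 1 <= p) (hq : 1 <= q) (hr : 1 <= r) :
  (exists C : R, (0 < C)%R /\
    forall phi : R -> R,
      torus_continuous phi -> (exists x : R, phi x <> 0%R) -> zero_mean phi ->
      sign_changes phi < +oo ->
      sign_changes phi `^ alpha * negative_sobolev_norm s phi >=
      C%:E * (torus_norm p phi * torus_norm q phi / torus_norm r phi))
  <->
  ((1 <= alpha)%R /\ p^-1 + q^-1 - r^-1 >= 1 + s%:E^-1).
Proof.
split=> [[C [C0 H]]|[_ H]]; first by split=> //; exact: necessity hs halpha hp hq hr C0 H.
exists 48^-1%R; split; first by rewrite invr_gt0.
exact: sufficiency.
Qed.
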